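(* Let $H$ be a connected hypergraph in which every hyperedge contains more than two vertices, let $w_{1}:V(H)\to\{0,1\}$ be an initial configuration that is not identically zero, and let $w_{2}:V(H)\to\{0,1\}$ be a configuration. There is a polynomial time algorithm that tests whether $w_{2}$ is a recurrent state for the nondeterministic hyperedge switching process on $H$ started at $w_{1}$.
   Context: A configuration assigns to each vertex a value in $\{0,1\}$ (1 meaning the vertex carries a ball). Nondeterministic hyperedge switching process: at each step one chooses a hyperedge $l$ containing at least one vertex with value $1$, and replaces the configuration $x$ by $x^{(l)}$, where $x^{(l)}(v)=1+x(v) \pmod 2$ for $v\in l$ and $x^{(l)}(v)=x(v)$ otherwise. A state $s$ is recurrent for the process started at $w_1$ if for every infinite path $\pi=(\pi_0=w_1,\pi_1,\ldots)$ of the process and every $n$, $s$ is reachable from $\pi_n$ by a finite sequence of moves. *)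

(* Defs.v *)
From mathcomp Require Import all_boot.
Set Implicit Arguments. Unset Strict Implicit. Unset Printing Implicit Defensive.

Definition config (n : nat) := {ffun 'I_n -> bool}.

Definition switch n (x : config n) (l : {set 'I_n}) : config n :=
  [ffun v => if v \in l then ~~ x v else x v].

Definition move n (E : {set {set 'I_n}}) : rel (config n) :=
  fun x y => [exists l in E, [exists v in l, x v] && (y == switch x l)].

Definition reachable n (E : {set {set 'I_n}}) (x s : config n) : bool :=
  connect (move E) x s.

Definition infinite_path n (E : {set {set 'I_n}}) (w1 : config n)
  (pi : nat -> config n) : Prop :=
  pi 0 = w1 /\ forall i, move E (pi i) (pi i.+1).

Definition recurrent n (E : {set {set 'I_n}}) (w1 s : config n) : Prop :=
  forall pi, infinite_path E w1 pi -> forall m, reachable E (pi m) s.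

Definition hadj n (E : {set {set 'I_n}}) : rel 'I_n :=
  fun u v => [exists e in E, (u \in e) && (v \in e)].

Definition hconnected n (E : {set {set 'I_n}}) : Prop :=
  forall u v : 'I_n, connect (hadj E) u v.

(* Model of computation: deterministic single-tape Turing machines     *)
(* with input alphabet {0,1,#} (encoded as option bool, None = #),     *)
(* a finite set of extra work symbols, and a two-way infinite tape.    *)

Inductive dir := DL | DR | DS.

Record TM := {
  tm_state : finType;
  tm_work : finType;
  tm_start : tm_state;
  (* tape symbols: None = blank, Some (inl s) = input symbol,
     Some (inr w) = work symbol; delta = None means "halt" *)
  tm_delta : tm_state -> option (option bool + tm_work) ->
             option (tm_state * option (option bool + tm_work) * dir);
  tm_accept : tm_state -> bool
}.

Definition tsym (M : TM) := option (option bool + tm_work M).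

(* configuration: state, left part of tape (reversed, nearest cell first),
   right part of tape starting with the scanned cell *)
Definition tconf (M : TM) := (tm_state M * seq (tsym M) * seq (tsym M))%type.

Definition tm_step (M : TM) (c : tconf M) : option (tconf M) :=
  let: (q, l, r) := c in
  match tm_delta q (head None r) with
  | None => None
  | Some (q', a, d) =>
      let r' := a :: behead r in
      match d with
      | DS => Some (q', l, r')
      | DR => Some (q', a :: l, behead r)
      | DL => match l with
              | [::] => Some (q', [::], None :: r')
              | b :: l' => Some (q', l', b :: r')
              end
      end
  end.

Fixpoint tm_run (M : TM) (t : nat) (c : tconf M) : option (tconf M) :=
  match tm_step c with
  | None => Some c
  | Some c' => match t with
               | 0 => None
               | t'.+1 => tm_run t' c'
               end
  end.

Definition tm_init (M : TM) (x : seq (option bool)) : tconf M :=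
  (tm_start M, [::], [seq Some (inl s) | s <- x]).

Definition enc_config n (w : config n) : seq (option bool) :=
  [seq Some (w i) | i <- enum 'I_n].

Definition enc_edge n (e : {set 'I_n}) : seq (option bool) :=
  [seq Some (i \in e) | i <- enum 'I_n].

Definition encode n (E : {set {set 'I_n}}) (w1 w2 : config n)
  : seq (option bool) :=
  enc_config w1 ++ None :: enc_config w2 ++ None ::
  flatten [seq enc_edge e ++ [:: None] | e <- enum E].

(* Main.v *)
Require Import Defs.
From mathcomp Require Import all_boot.
From HB Require Import structures.
From mathcomp Require Import zify.
Set Implicit Arguments. Unset Strict Implicit. Unset Printing Implicit Defensive.

(** Call two vertices twins if they lie in the same hyperedges; a move changes a configuration by a hyperedge, so it stays in its coset modulo the GF(2)-span of the hyperedges, and it preserves differences between twins.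
    If w1 is constant on the twin classes and there is only one class, then no infinite path exists and every state is recurrent.
    If w1 separates some twins, every state of the coset is reachable from every other: a hyperedge through such twins can always be switched, and the others are added along the connectivity of H.
    If some hyperedge meets three classes, every state other than the all-ones configuration is reachable from every nonzero state of its coset: three suitable hyperedges have this property, and it survives the addition of a hyperedge touching the previous ones, because the coset contains three states with a ball at a given vertex of the new hyperedge and at most two of them are unsuitable.
    Otherwise the process is that of balls moving on a connected graph of twin classes and annihilating when they meet, some vertices (the hyperedges that are a single class) absorbing balls; the recurrent states are those of the coset with at most two occupied classes, or at most one if there is an absorbing vertex.
    This criterion is decided by comparing columns of the incidence matrix, counting class representatives and Gaussian elimination, all done by repeated sweeps of a finite transducer over the tape. *)

(** * Reachability *)

Section Configurations.
Variable n : nat.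
Implicit Types (x y z s : config n) (e a b c : {set 'I_n}) (l : seq {set 'I_n}).

Lemma switchE x e v : switch x e v = x v (+) (v \in e).
Proof. by rewrite ffunE; case: (v \in e); rewrite ?addbT ?addbF. Qed.

Lemma switchK e : involutive (fun x => switch x e).
Proof. by move=> x; apply/ffunP=> v; rewrite !switchE addbK. Qed.

Lemma switchC x a b : switch (switch x a) b = switch (switch x b) a.
Proof. by apply/ffunP=> v; rewrite !switchE addbAC. Qed.

(* [flips l x s]: the difference of [x] and [s] lies in the GF(2)-span of [l]. *)
Fixpoint flips l x s :=
  if l is e :: l' then flips l' x s || flips l' (switch x e) s else x == s.

Lemma flips_refl l x : flips l x x.
Proof. by elim: l x => [|e l IH] x //=; rewrite IH. Qed.

Lemma flips_shift e l x s : flips l (switch x e) (switch s e) = flips l x s.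
Proof.
elim: l x => [|a l IH] x /=; last by rewrite IH switchC IH.
by rewrite (inj_eq (can_inj (switchK e))).
Qed.

Lemma flips_switch e l x s : e \in l -> flips l (switch x e) s = flips l x s.
Proof.
elim: l x => [|a l IH] x //=; rewrite inE; case/predU1P=> [->|el].
  by rewrite switchK orbC.
by rewrite switchC !IH.
Qed.

Lemma flips_shiftl e l x s : flips l (switch x e) s = flips l x (switch s e).
Proof. by rewrite -[LHS](flips_shift e) switchK. Qed.

(** The equality form rewrites the starting point inside a coset; [s := x] gives symmetry. *)
Lemma flips_trans l x y s : flips l x y -> flips l y s = flips l x s.
Proof.
elim: l x y s => [|a l IH] x y s /=; first by move/eqP->.
rewrite !flips_shiftl => /orP[] h; first by rewrite !(IH _ _ _ h).
by rewrite -!flips_shiftl in h *; rewrite (IH _ _ _ h) !flips_shiftl (IH _ _ _ h) flips_shiftl switchK orbC.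
Qed.

Lemma flips_sub l l' x s : {subset l <= l'} -> flips l x s -> flips l' x s.
Proof.
elim: l x => [|a l IH] x sub /=; first by move/eqP->; rewrite flips_refl.
have sub' : {subset l <= l'} by move=> e el; apply: sub; rewrite inE el orbT.
case/orP=> /(IH _ sub') //; rewrite flips_switch //.
by apply: sub; rewrite inE eqxx.
Qed.

Definition covered l v := has (fun e => v \in e) l.

Lemma flips_out l x s v : ~~ covered l v -> flips l x s -> x v = s v.
Proof.
elim: l x => [|a l IH] x /=; first by move=> _ /eqP->.
rewrite negb_or => /andP[va vl] /orP[] /(IH _ vl) //.
by rewrite switchE (negPf va) addbF.
Qed.

Lemma neq_covered l x z : flips l x z -> x != z -> exists2 v, covered l v & x v != z v.
Proof.
move=> xz xNz; have [/existsP[v h]|/existsPn eq] := boolP [exists v, x v != z v].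
  by exists v => //; apply: contraNT h => /flips_out/(_ xz) ->.
by case/eqP: xNz; apply/ffunP=> v; apply/eqP/negPn.
Qed.

End Configurations.

(** * Moves inside a coset of the GF(2)-span *)

Section Process.
Variables (n : nat) (E : {set {set 'I_n}}).
Implicit Types (x y z s : config n) (e a b c : {set 'I_n}) (l : seq {set 'I_n}).

Lemma reach_switch x e v : e \in E -> v \in e -> x v -> reachable E x (switch x e).
Proof.
move=> eE ve xv; apply/connect1/existsP; exists e; rewrite eE eqxx andbT.
by apply/existsP; exists v; rewrite ve.
Qed.

Lemma reach_trans x y z : reachable E x y -> reachable E y z -> reachable E x z.
Proof. exact: connect_trans. Qed.

Lemma moveP x y : reflect (exists e, [/\ e \in E, exists2 v, v \in e & x v & y = switch x e])
                          (move E x y).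
Proof.
apply: (iffP existsP) => [[e /and3P[eE /existsP[v /andP[ve xv]] /eqP ->]]|[e [eE [v ve xv] ->]]].
  by exists e; split=> //; exists v.
by exists e; rewrite eE eqxx andbT; apply/existsP; exists v; rewrite ve.
Qed.

Lemma reach_flips x s : reachable E x s -> flips (enum E) x s.
Proof.
case/connectP=> p; elim: p x => [|y p IH] x /=; first by move=> _ ->; apply: flips_refl.
case/andP=> /moveP[e [eE _ ->]] yp /(IH _ yp).
by rewrite flips_switch // mem_enum.
Qed.

(** Moves may use all of [E]; only the difference of [x] and [s] is confined to [l]. The two
    exclusions arise because no hyperedge of [l] can be switched without a covered ball, and
    switching one leaves an empty vertex. *)
Definition good l := forall x s,
  (exists2 v, covered l v & x v) -> (exists2 v, covered l v & ~~ s v) ->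
  flips l x s -> reachable E x s.

Lemma good_pair a b w : a \in E -> b \in E -> w \in a -> w \in b -> good [:: b; a].
Proof.
move=> aE bE wa wb x s [v vc xv] [u uc su] xs.
(* If [p] is empty, switch [q] to bring a ball to [w], then [p], then [q] back by means of [u]. *)
have key p q : p \in E -> q \in E -> w \in p -> w \in q ->
    (exists2 v, (v \in p) || (v \in q) & x v) ->
    (exists2 u, (u \in p) || (u \in q) & ~~ switch x p u) -> reachable E x (switch x p).
  move=> pE qE wp wq [{xv vc}v vpq xv'] [{su uc}u upq]; rewrite switchE => su'.
  have [/existsP[t /andP[tp xt]]|/existsPn no] := boolP [exists t, (t \in p) && x t].
    exact: reach_switch xt.
  have {}no t : t \in p -> x t = false by move=> tp; have := no t; rewrite tp => /negbTE.
  have vq : v \in q by case/orP: vpq => // /no; rewrite xv'.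
  apply: reach_trans (reach_switch qE vq xv') _.
  apply: (reach_trans (reach_switch (v := w) pE wp _)); first by rewrite switchE no ?wq.
  rewrite switchC -[X in reachable _ _ X](switchK q).
  have up : u \in p = false.
    by apply/negP => up; move: su'; rewrite up no.
  rewrite up /= in upq; rewrite up addbF in su'.
  by apply: (reach_switch qE upq); rewrite !switchE up upq (negPf su').
(* If [q] is empty once [p] is switched, the opposite order works: [q] from [w], then [p] from
   [u]. *)
have key2 p q : p \in E -> q \in E -> w \in p -> w \in q ->
    (exists2 v, (v \in p) & x v) ->
    (exists2 u, (u \in p) || (u \in q) & ~~ switch (switch x p) q u) ->
    reachable E x (switch (switch x p) q).
  move=> pE qE wp wq [{xv vc}v vp xv'] [{su uc}u upq su'].
  have [/existsP[t /andP[tp xt]]|/existsPn no] := boolP [exists t, (t \in q) && switch x p t].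
    exact: reach_trans (reach_switch pE vp xv') (reach_switch qE tp xt).
  have {}no t : t \in q -> x t = (t \in p).
    by move=> tp; have := no t; rewrite tp switchE; case: (x t); case: (t \in p).
  rewrite switchC; have xw : x w by rewrite no.
  apply: reach_trans (reach_switch qE wq xw) _.
  move: upq su'; rewrite !switchE; have [uq _|uq] := boolP (u \in q); first by rewrite no // addbb.
  rewrite orbF => up; rewrite up addbF addbT negbK => xu.
  by apply: (reach_switch pE up); rewrite switchE xu (negPf uq).
rewrite /covered /= !orbF in vc uc; rewrite /= in xs.
have vc' : (v \in a) || (v \in b) by rewrite orbC.
have uc' : (u \in a) || (u \in b) by rewrite orbC.
case/orP: xs => /orP[] /eqP sE; subst s.
- exact: connect0.
- by apply: (key a b) => //; [exists v|exists u].
- by apply: (key b a) => //; [exists v|exists u].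
case/orP: vc => vp; last by rewrite switchC in su *; apply: key2 => //; [exists v|exists u].
by apply: key2 => //; [exists v|exists u].
Qed.

(* The detour is x -> z -> switch z b -> s, its outer parts using only [l]. *)
Lemma good_cons l b : good l -> b \in E -> (exists2 v, v \in b & covered l v) ->
  (forall x, (exists2 v, covered l v & x v) ->
     exists z, [/\ flips l x z, exists2 v, v \in b & z v,
                   exists2 v, covered l v & ~~ z v &
                   exists2 v, covered l v & z v != (v \in b)]) ->
  good (b :: l).
Proof.
move=> gl bE [w wb wl] ex.
have main x s : (exists2 v, covered l v & x v) -> (exists2 v, covered l v & ~~ s v) ->
    flips (b :: l) x s -> reachable E x s.
  move=> xl sl /=; have [xs _|_ /= xs] := boolP (flips l x s); first exact: gl.
  have [z [xz [v vb zv] z1 [u ul zub]]] := ex x xl.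
  apply: reach_trans (gl _ _ xl z1 xz) _; apply: reach_trans (reach_switch bE vb zv) _.
  apply: gl => //; last by rewrite flips_shiftl (flips_trans _ xz) -flips_shiftl.
  by exists u => //; rewrite switchE; case: (z u) zub; case: (u \in b).
move=> x s [v vl xv] [u ul su] xs.
(* If [s] is full on the vertices of [l], the last move is [b], coming from [switch s b], which is
   empty at [w]. *)
have red_s y : (exists2 v, covered l v & y v) -> flips (b :: l) y s -> reachable E y s.
  move=> yl ys; have [/existsP[t /andP[tl st]]|/existsPn s1] := boolP [exists t, covered l t && ~~ s t].
    by apply: main => //; exists t.
  have {}s1 t : covered l t -> s t by move=> tl; have := s1 t; rewrite tl negbK.
  have ub : u \in b by case/orP: ul => // /s1; rewrite (negPf su).
  apply: reach_trans (_ : reachable E (switch s b) s).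
    apply: main => //; last by rewrite -flips_shiftl flips_switch // inE eqxx.
    by exists w => //; rewrite switchE wb s1.
  by rewrite -{2}(switchK b s); apply: (reach_switch bE ub); rewrite switchE ub (negPf su).
(* Dually, if [x] is empty there, the first move is [b], which puts a ball at [w]. *)
have [/existsP[t /andP[tl xt]]|/existsPn x0] := boolP [exists t, covered l t && x t].
  by apply: red_s => //; exists t.
have {}x0 t : covered l t -> x t = false by move=> tl; have := x0 t; rewrite tl => /negbTE.
have vb : v \in b by case/orP: vl => // /x0; rewrite xv.
apply: reach_trans (reach_switch bE vb xv) _.
apply: red_s; last by rewrite flips_switch // inE eqxx.
by exists w => //; rewrite switchE wb x0.
Qed.

Definition twin u v := [forall e in E, (u \in e) == (v \in e)].

Lemma twinP u v : reflect (forall e, e \in E -> (u \in e) = (v \in e)) (twin u v).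
Proof. by apply: (iffP forall_inP) => h e eE; apply/eqP/h. Qed.

Lemma twin_refl u : twin u u. Proof. exact/twinP. Qed.

Lemma twin_sym u v : twin u v = twin v u.
Proof. by apply/twinP/twinP=> h e eE; rewrite h. Qed.

Lemma twin_trans u v w : twin u v -> twin v w -> twin u w.
Proof. by move=> /twinP uv /twinP vw; apply/twinP=> e eE; rewrite uv ?vw. Qed.

Lemma ntwinP u v : ~~ twin u v -> exists2 e, e \in E & (u \in e) != (v \in e).
Proof. by case/forall_inPn=> e eE ne; exists e. Qed.

(** The candidates [z0], [z1] have a ball at [u], agree at [v] and differ at some covered [t].
    Whatever their value at [v], one of them has an empty vertex and also differs from [c]
    somewhere. *)
Lemma good_triple a b c w u v : a \in E -> b \in E -> c \in E -> 
  w \in a -> w \in b -> b != set0 -> a != b -> 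
  u \in a -> v \in a -> (u \in b) = (v \in b) -> u \in c -> v \notin c ->
  good [:: c; b; a].
Proof.
move=> aE bE cE wa wb b0 ab ua va uvb uc vc.
apply: good_cons => //; first exact: good_pair wa wb.
  by exists u; rewrite //= ua orbT.
move=> x _; set l := [:: b; a].
have al : a \in l by rewrite !inE eqxx orbT.
have bl : b \in l by rewrite !inE eqxx.
pose z0 := if x u then x else switch x a.
have xz0 : flips l x z0.
  by rewrite /z0; case: (x u); rewrite -?flips_shiftl ?flips_switch ?flips_refl.
have z0u : z0 u by rewrite /z0; case E0: (x u) => //; rewrite switchE E0 ua.
(* The difference is [b] or the sum of [a] and [b], whichever vanishes at [u] and [v]. *)
pose z1 := if u \in b then switch (switch z0 b) a else switch z0 b.
have z0z1 : flips l z0 z1.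
  by rewrite /z1; case: (u \in b); rewrite -!flips_shiftl !flips_switch ?flips_refl.
have z1u : z1 u by rewrite /z1; case E0: (u \in b); rewrite !switchE E0 ?ua z0u.
have z1v : z1 v = z0 v.
  by rewrite /z1; case E0: (u \in b); rewrite !switchE -uvb E0 ?va ?addbT ?addbF ?negbK.
have z01 : z0 != z1.
  rewrite /z1; case: ifP => _; apply: contraNneq (_ : a != b) => // h; last first.
    by case/set0Pn: b0 => t tb; move/ffunP/(_ t): h; rewrite switchE tb; case: (z0 t).
  by apply/eqP/setP=> t; move/ffunP/(_ t): h; rewrite !switchE; case: (z0 t); case: (t \in a); case: (t \in b).
have xz1 : flips l x z1 by rewrite -(flips_trans _ xz0).
have [t tl z01t] := neq_covered z0z1 z01.
have ul : covered l u by rewrite /covered /= ua orbT.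
have vl : covered l v by rewrite /covered /= va orbT.
have pick : exists z, [/\ flips l x z, z u, z v = z0 v & (z t == (t \in c)) = false].
  have [h|h] := boolP (z0 t == (t \in c)).
    by exists z1; split=> //; rewrite -(eqP h) eq_sym; apply/negbTE.
  by exists z0; split=> //; apply/negbTE.
case E0: (z0 v).
  have [h|h] := boolP (z0 t).
    exists z1; split=> //; [by exists u|exists t => //|exists v => //].
      by rewrite h in z01t; case: (z1 t) z01t.
    by rewrite z1v E0 (negPf vc).
  exists z0; split=> //; [by exists u|by exists t|exists v => //].
  by rewrite E0 (negPf vc).
have [z [xz zu zv zt]] := pick.
exists z; split=> //; [by exists u|exists v => //; by rewrite zv E0|exists t => //].
by rewrite zt.
Qed.

(** Three states leave a choice after the two unsuitable ones are discarded: the one full on the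
    covered vertices and the one equal to the new hyperedge there. *)
Definition rich l := forall x v, exists z1 z2 z3,
  [/\ [/\ flips l x z1, flips l x z2 & flips l x z3], [/\ z1 v = x v, z2 v = x v & z3 v = x v] &
      [/\ z1 != z2, z1 != z3 & z2 != z3]].

Lemma rich_cons l b : rich l -> rich (b :: l).
Proof.
move=> rl x v; have [z1 [z2 [z3 [[h1 h2 h3] hv hn]]]] := rl x v.
by exists z1, z2, z3; split=> //=; rewrite h1 h2 h3.
Qed.

(** States of one coset that agree on the covered vertices are equal. Hence, of three states with a
    ball at [w], at most one is full and at most one coincides with [b]; a remaining one is the
    detour for [good_cons]. *)
Lemma good_cons_rich l b : rich l -> good l -> b \in E -> (exists2 v, v \in b & covered l v) ->
  good (b :: l).
Proof.
move=> rl gl bE [w wb wl]; apply: good_cons => // [|x _]; first by exists w.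
have /hasP[e el we] := wl.
pose x0 := if x w then x else switch x e.
have xx0 : flips l x x0.
  by rewrite /x0; case: (x w); rewrite -?flips_shiftl ?flips_switch ?flips_refl.
have x0w : x0 w by rewrite /x0; case E0: (x w) => //; rewrite switchE E0 we.
have [z1 [z2 [z3 [[h1 h2 h3] [v1 v2 v3] [n12 n13 n23]]]]] := rl x0 w.
have ok z : flips l x0 z -> z w = x0 w ->
    (exists2 v, covered l v & ~~ z v) -> (exists2 v, covered l v & z v != (v \in b)) ->
    exists z, [/\ flips l x z, exists2 v, v \in b & z v,
                   exists2 v, covered l v & ~~ z v &
                   exists2 v, covered l v & z v != (v \in b)].
  move=> xz zw z1' zb'; exists z; split=> //; last by exists w; rewrite ?zw.
  by rewrite -(flips_trans _ xx0).
pose one z := [forall v, covered l v ==> z v]; pose isb z := [forall v, covered l v ==> (z v == (v \in b))].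
have oneN z : ~~ one z -> exists2 v, covered l v & ~~ z v.
  by move/forallPn=> [v]; rewrite negb_imply => /andP[]; exists v.
have isbN z : ~~ isb z -> exists2 v, covered l v & z v != (v \in b).
  by move/forallPn=> [v]; rewrite negb_imply => /andP[]; exists v.
have uniq1 y z : flips l x0 y -> flips l x0 z -> y != z -> one y -> one z -> False.
  move=> xy; rewrite -(flips_trans _ xy) => yz ne /forallP oy /forallP oz.
  have [t tl] := neq_covered yz ne; move: (oy t) (oz t); rewrite tl /=.
  by move=> -> ->.
have uniqb y z : flips l x0 y -> flips l x0 z -> y != z -> isb y -> isb z -> False.
  move=> xy; rewrite -(flips_trans _ xy) => yz ne /forallP oy /forallP oz.
  have [t tl] := neq_covered yz ne; move: (oy t) (oz t); rewrite tl /=.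
  by move=> /eqP -> /eqP ->; rewrite eqxx.
have [o1|/oneN o1] := boolP (one z1); last have [b1|/isbN b1] := boolP (isb z1); last exact: (ok z1).
- have [b2|/isbN b2] := boolP (isb z2).
    have [o3|/oneN o3] := boolP (one z3); first by case: (uniq1 _ _ h1 h3).
    have [b3|/isbN b3] := boolP (isb z3); first by case: (uniqb _ _ h2 h3).
    exact: (ok z3).
  have [o2|/oneN o2] := boolP (one z2); first by case: (uniq1 _ _ h1 h2).
  exact: (ok z2).
- have [b2|/isbN b2] := boolP (isb z2); first by case: (uniqb _ _ h1 h2).
  have [o2|/oneN o2] := boolP (one z2); last exact: (ok z2).
  have [o3|/oneN o3] := boolP (one z3); first by case: (uniq1 _ _ h2 h3).
  have [b3|/isbN b3] := boolP (isb z3); first by case: (uniqb _ _ h1 h3).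
  exact: (ok z3).
Qed.

(** The values at [u], [v], [w] make [a], [b], [c] independent. Vanishing at [t] is one linear
    condition, so at least four of the eight combinations satisfy it. *)
Lemma rich_triple a b c u v w : u \in a -> v \in a -> w \in a ->
  (u \in b) = (v \in b) -> (w \in b) = ~~ (v \in b) -> u \in c -> v \notin c ->
  rich [:: c; b; a].
Proof.
move=> ua va wa ub wb uc /negbTE vc x t.
pose X i j k : config n :=
  let y := if i then switch x a else x in
  let y := if j then switch y b else y in if k then switch y c else y.
have XE i j k r : X i j k r = x r (+) (i && (r \in a)) (+) (j && (r \in b)) (+) (k && (r \in c)).
  by rewrite /X; case: i j k => [] [] []; rewrite /= ?switchE ?addbF.
have Xflips i j k : flips [:: c; b; a] x (X i j k).
  by rewrite /X; case: i j k => [] [] []; rewrite -?flips_shiftl ?flips_switch ?flips_refl // !inE eqxx ?orbT.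
have Xinj i j k i' j' k' : X i j k = X i' j' k' -> [/\ i = i', j = j' & k = k'].
  move=> /ffunP h; have := (h u, h v, h w); rewrite {h} !XE ua va wa wb ub uc vc -!addbA.
  case=> [[/addbI + /addbI +] /addbI].
  by case: (v \in b) (w \in c) i j k i' j' k' => [] [] [] [] [] [] [] [].
have pick i j k i' j' k' : (i, j, k) != (false, false, false) -> (i', j', k') != (false, false, false) ->
    (i, j, k) != (i', j', k') ->
    (i && (t \in a)) (+) (j && (t \in b)) (+) (k && (t \in c)) = false ->
    (i' && (t \in a)) (+) (j' && (t \in b)) (+) (k' && (t \in c)) = false ->
    exists z1 z2 z3,
      [/\ [/\ flips [:: c; b; a] x z1, flips [:: c; b; a] x z2 & flips [:: c; b; a] x z3],
          [/\ z1 t = x t, z2 t = x t & z3 t = x t] & [/\ z1 != z2, z1 != z3 & z2 != z3]].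
  move=> n1 n2 n3 e1 e2; exists (X false false false), (X i j k), (X i' j' k').
  split; first by rewrite !Xflips.
    by rewrite -!addbA in e1 e2; rewrite !XE -!addbA e1 e2 /= !addbF.
  split; apply/eqP => /Xinj[i1 i2 i3].
  - by move: n1; rewrite -i1 -i2 -i3 eqxx.
  - by move: n2; rewrite -i1 -i2 -i3 eqxx.
  - by move: n3; rewrite i1 i2 i3 eqxx.
case ta: (t \in a) pick; case tb: (t \in b); case tc: (t \in c) => pick.
- exact: (pick true true false true false true).
- exact: (pick true true false false false true).
- exact: (pick false true false true false true).
- exact: (pick false true false false false true).
- exact: (pick true false false false true true).
- exact: (pick true false false false false true).
- exact: (pick true false false false true false).
- exact: (pick true false false false true false).
Qed.

(** * Extension along the connectivity of the hypergraph *)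

Hypothesis conn : hconnected E.
Hypothesis edge0 : forall e, e \in E -> e != set0.

(** While [l] is incomplete, some hyperedge outside [l] touches it: a path from [v0] to an uncovered
    vertex leaves the covered set through one, and if all vertices are covered any missing hyperedge
    will do. *)
Lemma grow (P : seq {set 'I_n} -> Prop) l0 v0 :
  {subset l0 <= enum E} -> covered l0 v0 -> P l0 ->
  (forall l b, {subset l0 <= l} -> b \in E -> P l ->
     (exists2 v, v \in b & covered l v) -> P (b :: l)) ->
  exists2 l, P l & l =i enum E.
Proof.
move=> sub v0l P0 step.
suff gen k l : #|[set e in E | e \notin l]| <= k -> {subset l0 <= l} -> {subset l <= enum E} -> P l ->
    exists2 l, P l & l =i enum E.
  exact: (gen _ l0 (leqnn _)).
elim: k l => [|k IH] l.
  rewrite leqn0 cards_eq0 => /eqP l1 sl0 sl Pl; exists l => // e.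
  apply/idP/idP => [/sl//|]; rewrite mem_enum => eE; apply: contraTT eE => el.
  by apply/negP => eE; have := in_set0 e; rewrite -l1 inE eE el.
move=> le sl0 sl Pl.
have v0l' : covered l v0.
  by case/hasP: v0l => e el ve; apply/hasP; exists e => //; apply: sl0.
suff: l =i enum E \/ exists b, [/\ b \in E, b \notin l & exists2 v, v \in b & covered l v].
  case=> [|[b [bE bl touch]]]; first by exists l.
  apply: (IH (b :: l)).
  - rewrite -ltnS; apply: leq_trans le; apply: proper_card; apply/properP; split.
      by apply/subsetP=> e; rewrite !inE negb_or => /and3P[-> _ ->].
    by exists b; rewrite !inE ?bE ?eqxx.
  - by move=> e el0; rewrite inE sl0 ?orbT.
  - by move=> e; rewrite inE => /predU1P[->|/sl//]; rewrite mem_enum.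
  - exact: step.
have [/forallP call|/forallPn[u uNl]] := boolP [forall u, covered l u].
  have [/existsP[b /andP[bE bl]]|/existsPn no] := boolP [exists b, (b \in E) && (b \notin l)].
    right; exists b; split=> //; case/set0Pn: (edge0 bE) => v vb; by exists v.
  left=> e; apply/idP/idP => [/sl//|]; rewrite mem_enum => eE.
  by have := no e; rewrite eE /= negbK.
right.
have /connectP[p] := conn v0 u.
elim: p v0 {v0l} v0l' => [|w p IHp] v vl /=; first by move=> _ uv; rewrite uv vl in uNl.
case/andP=> /exists_inP[e eE /andP[ve we]] wp lst.
have [wl|wNl] := boolP (covered l w); first exact: IHp wl wp lst.
exists e; split=> //; last by exists v.
by apply: contra wNl => el; apply/hasP; exists e.
Qed.

(** Some [b] separates two of the three vertices, and the third agrees on [b] with one of them; a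
    [c] separating that pair completes a good and rich triple, which [grow] extends to [E]. *)
Lemma reach_big a u1 u2 u3 x s : a \in E -> u1 \in a -> u2 \in a -> u3 \in a ->
  ~~ twin u1 u2 -> ~~ twin u2 u3 -> ~~ twin u3 u1 ->
  (exists v, x v) -> (exists v, ~~ s v) -> flips (enum E) x s -> reachable E x s.
Proof.
move=> aE u1a u2a u3a n12 n23 n31 [p xp] [q sq] xs.
have base b u v w c : b \in E -> c \in E -> u \in a -> v \in a -> w \in a ->
    (u \in b) = (v \in b) -> (w \in b) = ~~ (v \in b) -> u \in c -> v \notin c ->
    good [:: c; b; a] /\ rich [:: c; b; a].
  move=> bE cE ua va wa ub wb uc vc; split; last exact: rich_triple wb uc vc.
  have [r ra rb] : exists2 r, r \in a & r \in b.
    by case vb: (v \in b) wb => wb; [exists v|exists w].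
  apply: (good_triple (w := r) (u := u) (v := v)) => //; first by apply/set0Pn; exists r.
  by apply/eqP => ab; move: wb; rewrite -ab wa va.
have base' b u v w : b \in E -> u \in a -> v \in a -> w \in a -> ~~ twin u v ->
    (u \in b) = (v \in b) -> (w \in b) = ~~ (v \in b) ->
    exists l, [/\ {subset l <= enum E}, exists v, covered l v & good l /\ rich l].
  move=> bE ua va wa /ntwinP[c cE cuv] ub wb; exists [:: c; b; a]; split.
  - by move=> e; rewrite !inE mem_enum => /or3P[] /eqP ->.
  - by exists u; rewrite /= ua !orbT.
  case uc: (u \in c) cuv => cuv; first by apply: (base b u v w) => //; rewrite eq_sym eqb_id in cuv.
  by apply: (base b v u w) => //; rewrite ?ub ?uc //; case: (v \in c) cuv.
have [l0 [sub [v0 v0l] gr]] :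
    exists l, [/\ {subset l <= enum E}, exists v, covered l v & good l /\ rich l].
  have /ntwinP[b bE b12] := n12.
  have [b13|b13] := eqVneq (u3 \in b) (u1 \in b).
    apply: (base' b u3 u1 u2) => //.
    by move: b12; case: (u1 \in b); case: (u2 \in b).
  apply: (base' b u2 u3 u1) => //; move: b12 b13.
    by case: (u1 \in b); case: (u2 \in b); case: (u3 \in b).
  by case: (u1 \in b); case: (u2 \in b); case: (u3 \in b).
have [l [gl _] lE] : exists2 l, good l /\ rich l & l =i enum E.
  apply: grow sub v0l gr _ => l b _ bE [gl rl] touch.
  by split; [apply: good_cons_rich|apply: rich_cons].
(* [good] only speaks of covered vertices; as there are at least two vertices, connectivity covers
   all. *)
have cov r : covered l r.
  have [w rw] : exists w, w != r.
    by exists (if u1 == r then u2 else u1); case: (eqVneq u1 r) => [<-|//]; apply: contraNneq n12 => ->; apply: twin_refl.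
  have /connectP[[|r' path_r]] := conn r w; first by move=> _ wr; rewrite wr eqxx in rw.
  move=> /= /andP[/exists_inP[e eE /andP[re _]] _] _.
  by apply/hasP; exists e; rewrite ?lE ?mem_enum.
apply: gl; [by exists p|by exists q|].
by apply: flips_sub xs => e; rewrite lE.
Qed.

Lemma flips_twin x s u v : twin u v -> flips (enum E) x s -> x u (+) x v = s u (+) s v.
Proof.
move=> /twinP uv.
suff gen l : {subset l <= enum E} -> flips l x s -> x u (+) x v = s u (+) s v by apply: gen.
elim: l x => [|e l IH] x sub /=; first by move/eqP->.
have sub' : {subset l <= enum E} by move=> a al; apply: sub; rewrite inE al orbT.
case/orP=> /(IH _ sub') // <-; rewrite !switchE uv; last by rewrite -mem_enum sub ?inE ?eqxx.
by case: (x u); case: (x v); case: (v \in e).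
Qed.

(** Every state of the coset has exactly one ball on [u] and [v], so a hyperedge [f] through both
    can always be switched. To add a hyperedge [b], move first inside the span of [l] to a state
    with a ball at a common vertex. *)
Lemma reach_mixed (w : config n) u v x s : twin u v -> w u != w v ->
  flips (enum E) w x -> flips (enum E) x s -> reachable E x s.
Proof.
move=> uv wuv.
have uNv : u != v by apply: contraNneq wuv => ->.
have /connectP[[|q p]] := conn u v; first by move=> _ vu; rewrite vu eqxx in uNv.
move=> /= /andP[/exists_inP[f fE /andP[uf _]] _] _.
have vf : v \in f by rewrite -(twinP _ _ uv).
pose P l := {subset l <= enum E} /\
  forall x s, flips (enum E) w x -> flips l x s -> reachable E x s.
have sub : {subset [:: f] <= enum E} by move=> e; rewrite inE mem_enum => /eqP->.
have cv : covered [:: f] u by rewrite /= uf.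
have Pf : P [:: f].
  split=> // {}x {}s wx /= /orP[] /eqP <-; first exact: connect0.
  have [xu|xu] := boolP (x u); first exact: reach_switch xu.
  apply: (reach_switch fE vf); have := flips_twin uv wx.
  by case: (w u) (w v) (x u) (x v) wuv xu => [] [] [] [].
have [l [_ Pl] lE] : exists2 l, P l & l =i enum E.
  apply: grow sub cv Pf _ => l b _ bE [lE Pl] [r rb /hasP[e el re]]; split.
    by move=> a; rewrite inE => /predU1P[->|/lE//]; rewrite mem_enum.
  move=> {}x {}s wx /= /orP[]; first exact: Pl.
  move=> xs; pose z := if x r then x else switch x e.
  have xz : flips l x z.
    by rewrite /z; case: (x r); rewrite -?flips_shiftl ?flips_switch ?flips_refl.
  have zr : z r by rewrite /z; case xr: (x r) => //; rewrite switchE xr re.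
  have wz : flips (enum E) w z.
    rewrite -(flips_trans _ wx) /z; case: (x r); first exact: flips_refl.
    by rewrite -flips_shiftl flips_switch ?flips_refl // lE.
  apply: reach_trans (Pl _ _ wx xz) _; apply: reach_trans (reach_switch bE rb zr) _.
  apply: Pl; first by rewrite -flips_shiftl flips_switch ?mem_enum.
  by rewrite flips_shiftl (flips_trans _ xz) -flips_shiftl.
move=> wx xs; apply: Pl => //; by apply: flips_sub xs => e; rewrite lE.
Qed.

(** * Twin classes and their representatives *)

Variable R : {set 'I_n}.
Hypothesis rep_ex : forall u, exists2 r, r \in R & twin u r.
Hypothesis rep_uniq : {in R &, forall r r', twin r r' -> r = r'}.
Implicit Types X Y S : {set 'I_n}.

Definition symdiff X Y := [set v | (v \in X) (+) (v \in Y)].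

Lemma card_symdiff X Y : #|symdiff X Y| + #|X :&: Y|.*2 = #|X| + #|Y|.
Proof.
have -> : symdiff X Y = (X :\: Y) :|: (Y :\: X).
  by apply/setP=> v; rewrite !inE; case: (v \in X); case: (v \in Y).
rewrite cardsU (_ : (X :\: Y) :&: (Y :\: X) = set0); last first.
  by apply/setP=> v; rewrite !inE; case: (v \in X); case: (v \in Y).
rewrite cards0 subn0 -(cardsID Y X) -(cardsID X Y) [Y :&: X]setIC -addnn.
by rewrite [RHS]addnACA addnC.
Qed.

(** The state constant on twin classes whose occupied classes are those of [X]; [reps] recovers
    [X]. *)
Definition blowup X : config n := [ffun v => [exists r in X, twin v r]].

Lemma blowupE X u r : X \subset R -> r \in R -> twin u r -> blowup X u = (r \in X).
Proof.
move=> /subsetP XR rR ur; rewrite ffunE; apply/exists_inP/idP => [[t tX ut]|rX]; last by exists r.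
by rewrite (rep_uniq rR (XR _ tX)) // (twin_trans _ ut) // twin_sym.
Qed.

Lemma switch_blowup X e : X \subset R -> e \in E ->
  switch (blowup X) e = blowup (symdiff X (e :&: R)).
Proof.
move=> XR eE; apply/ffunP=> v; have [r rR vr] := rep_ex v.
rewrite switchE (blowupE XR rR vr) (blowupE _ rR vr) ?inE ?rR ?andbT.
  by rewrite (twinP _ _ vr).
apply/subsetP=> t; rewrite !inE => ht; apply: contraTT ht => tR.
by rewrite (negPf tR) andbF addbF; apply: contra tR; apply: (subsetP XR).
Qed.

Definition reps (x : config n) := [set r in R | x r].

Lemma reps_sub x : reps x \subset R.
Proof. by apply/subsetP=> r; rewrite inE => /andP[]. Qed.

Lemma blowup_reps x : (forall u v, twin u v -> x u = x v) -> blowup (reps x) = x.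
Proof.
move=> cx; apply/ffunP=> v; have [r rR vr] := rep_ex v.
by rewrite (blowupE (reps_sub _) rR vr) inE rR (cx _ _ vr).
Qed.

Lemma reps_blowup X : X \subset R -> reps (blowup X) = X.
Proof.
move=> XR; apply/setP=> r; rewrite inE.
have [rR|rR] := boolP (r \in R); first by rewrite (blowupE XR rR (twin_refl r)).
by apply/esym/negbTE; apply: contra rR; apply: (subsetP XR).
Qed.

(** * Annihilating balls on the graph of twin classes *)

Section SmallEdges.
Hypothesis small : forall e, e \in E -> #|e :&: R| <= 2.

Lemma reach_blowup_switch X e u : X \subset R -> e \in E -> u \in X -> u \in e ->
  reachable E (blowup X) (blowup (symdiff X (e :&: R))).
Proof.
move=> XR eE uX ue; rewrite -switch_blowup //; apply: (reach_switch eE ue).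
by rewrite (blowupE XR (subsetP XR _ uX) (twin_refl u)).
Qed.

Lemma edge_pair e u v : e \in E -> u \in R -> v \in R -> u != v -> u \in e -> v \in e ->
  e :&: R = [set u; v].
Proof.
move=> eE uR vR uv ue ve; apply/esym/eqP; rewrite eqEcard cards2 uv small // andbT.
by apply/subsetP=> t; rewrite !inE => /orP[] /eqP ->; apply/andP.
Qed.

(* If the next vertex on a path from u to v already carries a ball, that ball is moved first; a ball
   at v is annihilated. *)
Lemma reach_toggle2 X u v : X \subset R -> u \in X -> v \in R -> u != v ->
  reachable E (blowup X) (blowup (symdiff X [set u; v])).
Proof.
suff gen p (a : 'I_n) : path (hadj E) a p -> twin a u -> twin (last a p) v ->
    X \subset R -> u \in X -> v \in R -> u != v ->
    reachable E (blowup X) (blowup (symdiff X [set u; v])).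
  have /connectP[p up vp] := conn u v.
  by apply: (gen p u up (twin_refl u)); rewrite -vp twin_refl.
move=> + + + + + vR; elim: p a u X => [|b p IH] a u X /=.
  move=> _ au av XR uX; rewrite (rep_uniq (subsetP XR _ uX) vR) ?eqxx //.
  by apply: twin_trans av; rewrite twin_sym.
case/andP=> /exists_inP[e eE /andP[ae be]] bp au lv XR uX uv.
have uR := subsetP XR _ uX.
have [w wR bw] := rep_ex b.
(* Such a step stays inside the class of [u] and is skipped. *)
have [wu|wu] := eqVneq w u; first by apply: (IH b) => //; rewrite -wu.
have ue : u \in e by rewrite -(twinP _ _ au).
have we : w \in e by rewrite -(twinP _ _ bw).
have eR : e :&: R = [set u; w] by apply: edge_pair; rewrite // eq_sym.
have [<-|wv] := eqVneq w v; first by rewrite -eR; apply: reach_blowup_switch uX ue.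
have sub Y t1 t2 : Y \subset R -> t1 \in R -> t2 \in R -> symdiff Y [set t1; t2] \subset R.
  move=> YR t1R t2R; apply/subsetP=> t; rewrite !inE.
  have [/(subsetP YR)//|_ /orP[] /eqP ->//] := boolP (t \in Y).
have [wX|wX] := boolP (w \in X).
  apply: reach_trans (IH b w X bp bw lv XR wX wv) _.
  have uX' : u \in symdiff X [set w; v].
    by rewrite !inE uX (negPf uv) eq_sym (negPf wu).
  have := reach_blowup_switch (sub _ _ _ XR wR vR) eE uX' ue; rewrite eR.
  congr (reachable _ _ (blowup _)); apply/setP=> t; rewrite !inE -addbA; congr (_ (+) _).
  have [->|tu] := eqVneq t u; first by rewrite eq_sym (negPf wu) (negPf uv).
  have [->|tw] := eqVneq t w; first by rewrite (negPf wv).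
  by case: (t == v).
apply: reach_trans (reach_blowup_switch XR eE uX ue) _; rewrite eR.
have wX' : w \in symdiff X [set u; w] by rewrite !inE (negPf wX) eqxx orbT.
have := IH b w _ bp bw lv (sub _ _ _ XR uR wR) wX' wv.
congr (reachable _ _ (blowup _)); apply/setP=> t; rewrite !inE -addbA; congr (_ (+) _).
have [->|tu] := eqVneq t u; first by rewrite eq_sym (negPf wu) (negPf uv).
have [->|tw] := eqVneq t w; first by rewrite (negPf wv).
by case: (t == v).
Qed.

Lemma reach_shift X u v : X \subset R -> u \in X -> v \in R -> v \notin X ->
  reachable E (blowup X) (blowup (v |: (X :\ u))).
Proof.
move=> XR uX vR vX; have uv : u != v by apply: contraNneq vX => <-.
have := reach_toggle2 XR uX vR uv; congr (reachable _ _ (blowup _)).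
apply/setP=> t; rewrite !inE.
have [->|tu] := eqVneq t u; first by rewrite uX (negPf uv).
have [->|tv] := eqVneq t v; first by rewrite (negPf vX).
by rewrite addbF.
Qed.

Lemma reach_annihilate X u v : X \subset R -> u \in X -> v \in X -> u != v ->
  reachable E (blowup X) (blowup (X :\ u :\ v)).
Proof.
move=> XR uX vX uv; have := reach_toggle2 XR uX (subsetP XR _ vX) uv.
congr (reachable _ _ (blowup _)); apply/setP=> t; rewrite !inE.
have [->|tu] := eqVneq t u; first by rewrite uX andbF.
have [->|tv] := eqVneq t v; first by rewrite vX.
by rewrite addbF.
Qed.

(** Induction on the number of misplaced balls, each shifted to an empty place of [S]. *)
Lemma reach_eqcard X S : X \subset R -> S \subset R -> #|X| = #|S| ->
  reachable E (blowup X) (blowup S).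
Proof.
move=> XR SR; move: {2}#|X :\: S| (leqnn #|X :\: S|) => k.
elim: k X XR => [|k IH] X XR le eqXS.
  rewrite leqn0 cards_eq0 setD_eq0 in le.
  have -> : X = S by apply/eqP; rewrite eqEcard le eqXS /=.
  exact: connect0.
have [->|] := eqVneq X S; first exact: connect0.
rewrite eqEcard eqXS leqnn andbT => /subsetPn[u uX uS].
have : S :\: X != set0.
  rewrite -card_gt0; have : 0 < #|X :\: S| by apply/card_gt0P; exists u; rewrite inE uX uS.
  by have := cardsID S X; have := cardsID X S; rewrite [S :&: X]setIC eqXS => <- /addnI ->.
case/set0Pn=> v; rewrite inE => /andP[vX vS].
apply: reach_trans (reach_shift XR uX (subsetP SR _ vS) vX) _.
apply: IH.
- by rewrite subUset sub1set (subsetP SR) //= (subset_trans _ XR) // subD1set.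
- rewrite -ltnS; apply: leq_trans le; apply: proper_card; apply/properP; split.
    apply/subsetP=> t; rewrite !inE => /andP[tS /orP[/eqP tv|/andP[_ ->]]]; last by rewrite tS.
    by rewrite tv vS in tS.
  by exists u; rewrite !inE ?uX ?uS // eqxx /= orbF; apply: contraNneq uS => ->.
by rewrite cardsU1 !inE (negPf vX) andbF -eqXS [RHS](cardsD1 u) uX.
Qed.

Lemma reps_switch x e : reps (switch x e) = symdiff (reps x) (e :&: R).
Proof.
by apply/setP=> r; rewrite !inE switchE; case: (r \in R); rewrite ?andbT ?andbF.
Qed.

(** A hyperedge that is a single twin class: its switch absorbs the ball there. *)
Definition hole := [exists e in E, #|e :&: R| == 1].

(** The ball at [u] moves to the absorbing class [h] and vanishes. If [h] is occupied, its ball is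
    deleted first and the ball at [u] replaces it. *)
Lemma reach_delete X u : hole -> X \subset R -> u \in X ->
  reachable E (blowup X) (blowup (X :\ u)).
Proof.
move=> /exists_inP[e eE /cards1P[h eh]] XR uX.
have /setIP[he hR] : h \in e :&: R by rewrite eh set11.
have del Y : Y \subset R -> h \in Y -> reachable E (blowup Y) (blowup (Y :\ h)).
  move=> YR hY; have := reach_blowup_switch YR eE hY he; rewrite eh.
  by congr (reachable _ _ (blowup _)); apply/setP=> t; rewrite !inE; case: eqVneq => [->|]; rewrite ?hY ?addbF.
have [uh|hu] := eqVneq u h; first by rewrite uh in uX *; apply: del.
have [hX|hX] := boolP (h \in X).
  apply: reach_trans (del X XR hX) _.
  have := @reach_shift (X :\ h) u h; rewrite !inE eqxx hu uX.
  move=> /(_ (subset_trans (subD1set _ _) XR) isT hR isT).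
  congr (reachable _ _ (blowup _)); apply/setP=> t; rewrite !inE.
  by case: (eqVneq t h) => [->|_]; rewrite ?hX 1?eq_sym ?hu.
apply: reach_trans (reach_shift XR uX hR hX) _.
have := @del (h |: (X :\ u)); rewrite setU11 subUset sub1set hR (subset_trans (subD1set _ _) XR).
move=> /(_ isT isT); congr (reachable _ _ (blowup _)).
by apply/setP=> t; rewrite !inE; case: (eqVneq t h) => [->|_] //; rewrite (negPf hX) andbF.
Qed.

Lemma reach_hole X S : hole -> X \subset R -> S \subset R -> #|S| <= #|X| ->
  reachable E (blowup X) (blowup S).
Proof.
move=> hl + SR; move: {2}(#|X| - #|S|) (erefl (#|X| - #|S|)) => k.
elim: k X => [|k IH] X kE XR le.
  by apply: reach_eqcard => //; apply/eqP; rewrite eqn_leq le -subn_eq0 kE.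
have lt : #|S| < #|X| by rewrite -subn_gt0 kE.
have /card_gt0P[u uX] : 0 < #|X| by apply: leq_trans lt.
apply: reach_trans (reach_delete hl XR uX) _; rewrite (cardsD1 u) uX in kE lt.
by apply: IH => //; [move: kE; rewrite subSn // => -[]|apply: subset_trans XR; apply: subD1set].
Qed.

Lemma reach_parity X S : X \subset R -> S \subset R -> #|S| <= #|X| -> odd #|X| = odd #|S| ->
  reachable E (blowup X) (blowup S).
Proof.
move=> + SR; move: {2}(#|X|) (leqnn #|X|) => k.
elim: k X => [|k IH] X kE XR le par.
  by apply: reach_eqcard => //; apply/eqP; rewrite eqn_leq le andbT (leq_trans kE).
have [eq|ne] := eqVneq #|X| #|S|; first exact: reach_eqcard.
(* Equal parities exclude a difference of one, so two balls can be spared. *)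
have lt : #|S|.+1 < #|X|.
  have lt : #|S| < #|X| by rewrite ltn_neqAle eq_sym ne.
  by rewrite ltn_neqAle lt andbT; apply: contra_eq_neq par => <- /=; case: (odd _).
have /card_gt1P[u [v [uX vX uv]]] : 1 < #|X| by apply: leq_trans lt.
apply: reach_trans (reach_annihilate XR uX vX uv) _.
have vX' : v \in X :\ u by rewrite !inE eq_sym uv.
rewrite (cardsD1 u) uX (cardsD1 v) vX' /= ?negbK in kE lt par.
apply: IH => //; first exact: ltnW.
  by apply: subset_trans XR; rewrite (subset_trans (subD1set _ _)) ?subD1set.
Qed.

(** Without a hole every hyperedge meets exactly two classes. *)
Lemma flips_parity x s : ~~ hole -> flips (enum E) x s -> odd #|reps x| = odd #|reps s|.
Proof.
move=> /exists_inPn nh.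
suff gen l : {subset l <= enum E} -> flips l x s -> odd #|reps x| = odd #|reps s| by apply: gen.
elim: l x => [|e l IH] x sub /=; first by move/eqP->.
have sub' : {subset l <= enum E} by move=> a al; apply: sub; rewrite inE al orbT.
have eE : e \in E by rewrite -mem_enum sub // inE eqxx.
have e2 : odd #|e :&: R| = false.
  have /set0Pn[v ve] := edge0 eE; have [r rR vr] := rep_ex v.
  have : 0 < #|e :&: R| by apply/card_gt0P; exists r; rewrite inE rR -(twinP _ _ vr) ?ve.
  by have := small eE; have := nh e eE; case: #|_| => [|[|[|]]].
case/orP=> /(IH _ sub') // <-; rewrite reps_switch.
have := congr1 odd (card_symdiff (reps x) (e :&: R)).
by rewrite !oddD odd_double e2 !addbF.
Qed.

(** A move touches at most two classes, at least one of them occupied: it frees at least as many as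
    it fills. *)
Lemma reach_reps_le x s : (forall u v, twin u v -> x u = x v) -> reachable E x s ->
  #|reps s| <= #|reps x|.
Proof.
move=> + /connectP[p]; elim: p x => [|y p IH] x cx /=; first by move=> _ ->.
case/andP=> /moveP[e [eE [v ve xv] ->]] ep /(IH _ _ ep) h.
apply: leq_trans (h _) _.
  by move=> a b ab; rewrite !switchE (cx _ _ ab) (twinP _ _ ab).
have [r rR vr] := rep_ex v.
rewrite reps_switch -(leq_add2r #|reps x :&: (e :&: R)|.*2) card_symdiff leq_add2l.
apply: leq_trans (small eE) _; rewrite -[2]/(1.*2) leq_double; apply/card_gt0P.
by exists r; rewrite !inE rR -(cx _ _ vr) xv -(twinP _ _ vr) ?ve.
Qed.

(** Without a hole, parities agree and [x] is nonzero, so a target with at most two occupied classes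
    has no more of them than [x]. *)
Lemma reach_small x s : (forall u v, twin u v -> x u = x v) -> (exists v, x v) ->
  #|reps s| <= (if hole then 1 else 2) -> flips (enum E) x s -> reachable E x s.
Proof.
move=> cx [v xv] le xs.
have cs (a b : 'I_n) : twin a b -> s a = s b.
  move=> ab; have := flips_twin ab xs; rewrite (cx _ _ ab) addbb.
  by case: (s a); case: (s b).
rewrite -(blowup_reps cx) -(blowup_reps cs).
have X0 : 0 < #|reps x|.
  have [r rR vr] := rep_ex v.
  by apply/card_gt0P; exists r; rewrite inE rR -(cx _ _ vr).
have := @flips_parity x s; case: ifP le => [hl|_] le par.
  by apply: reach_hole => //; rewrite ?reps_sub // (leq_trans le).
apply: reach_parity; rewrite ?reps_sub ?par //.
by have := par isT xs; case: #|reps s| #|reps x| le X0 => [|[|[|]]] // [|[|]].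
Qed.

End SmallEdges.

(** * The recurrence criterion *)

Lemma recurrent_move w y s : move E w y -> recurrent E w s -> recurrent E y s.
Proof.
move=> wy rw pi [pi0 piS] m.
apply: (rw (fun i => if i is j.+1 then pi j else w) _ m.+1).
by split=> // -[|i] //; rewrite pi0.
Qed.

Lemma recurrent_reach w y s : reachable E w y -> recurrent E w s -> recurrent E y s.
Proof.
case/connectP=> p; elim: p w => [|z p IH] w /=; first by move=> _ ->.
by case/andP=> wz zp zy /(recurrent_move wz); apply: IH.
Qed.

Definition all_twins := [forall u, forall v, twin u v].
Definition mixed (w : config n) := [exists u, exists v, twin u v && (w u != w v)].
Definition big := [exists e in E, 2 < #|e :&: R|].

Lemma mixedPn w : ~~ mixed w -> forall u v, twin u v -> w u = w v.
Proof.
move=> /existsPn no u v uv; have /existsPn/(_ v) := no u.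
by rewrite uv /= negbK => /eqP.
Qed.

(** Switching [e] empties [x] only if [x] equals [e]; then another hyperedge meeting [e] is switched
    instead. If there is none, connectivity makes [e] the only hyperedge and the whole vertex set,
    so all vertices are twins and [w] is constant. *)
Lemma live_step w x : ~~ (all_twins && ~~ mixed w) -> flips (enum E) w x -> (exists v, x v) ->
  exists2 y, move E x y & exists v, y v.
Proof.
move=> tw wx [v xv].
have step e u : e \in E -> u \in e -> x u -> (exists t, x t != (t \in e)) ->
    exists2 y, move E x y & exists v, y v.
  move=> eE ue xu [t xt]; exists (switch x e); first by apply/moveP; exists e; split=> //; exists u.
  by exists t; rewrite switchE; case: (x t) (t \in e) xt => [] [].
have [e eE ve] : exists2 e, e \in E & v \in e.
  have [/existsP[u uv]|/existsPn one] := boolP [exists u, u != v].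
    have /connectP[[|q p]] := conn v u; first by move=> _ vu; rewrite vu eqxx in uv.
    by case/andP=> /exists_inP[e eE /andP[ve _]] _ _; exists e.
  have {}one u : u = v by apply/eqP/negPn/one.
  case/negP: tw; apply/andP; split.
    by apply/forallP=> a; apply/forallP=> b; rewrite (one a) (one b) twin_refl.
  by apply/existsPn => a; apply/existsPn=> b; rewrite (one a) (one b) eqxx andbF.
have [/existsP[t xt]|/existsPn xe] := boolP [exists t, x t != (t \in e)].
  by apply: (step e v eE ve xv); exists t.
have {}xe t : x t = (t \in e) by apply/eqP/negPn/xe.
have [/existsP[f /and3P[fE fe /existsP[u /andP[uf ue]]]]|/existsPn no] :=
    boolP [exists f, [&& f \in E, f != e & [exists u, (u \in f) && (u \in e)]]].
  apply: (step f u fE uf); first by rewrite xe.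
  have [/existsP[t ht]|/existsPn eq] := boolP [exists t, x t != (t \in f)]; first by exists t.
  by case/eqP: fe; apply/setP=> t; have := eq t; rewrite negbK xe => /eqP.
have eT u : u \in e.
  have /connectP[p] := conn v u; elim: p v ve {xv} => [|b p IH] a ae /=; first by move=> _ ->.
  case/andP=> /exists_inP[f fE /andP[af bf]] bp; apply: (IH b _ bp).
  have := no f; rewrite fE /= negb_and negbK => /orP[/eqP <- //|/existsPn/(_ a)].
  by rewrite af ae.
have uniqE f : f \in E -> f = e.
  move=> fE; have /set0Pn[u uf] := edge0 fE.
  have := no f; rewrite fE /= negb_and negbK => /orP[/eqP //|/existsPn/(_ u)].
  by rewrite uf eT.
have alltw (a b : 'I_n) : twin a b by apply/twinP=> f /uniqE ->; rewrite !eT.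
case/negP: tw; apply/andP; split; first by apply/forallP=> a; apply/forallP=> b.
apply/existsPn => a; apply/existsPn=> b; rewrite alltw /= negbK.
by have := flips_twin (alltw a b) wx; rewrite !xe !eT; case: (w a) (w b) => [] [].
Qed.

Lemma live_path w x : ~~ (all_twins && ~~ mixed w) -> flips (enum E) w x -> (exists v, x v) ->
  exists pi, infinite_path E x pi.
Proof.
move=> tw wx xv.
(* The default [y] is never taken at nonzero states of the coset. *)
pose nxt y := odflt y [pick z | move E y z && [exists v, z v]].
have nxtP y : flips (enum E) w y -> (exists v, y v) -> move E y (nxt y) /\ exists v, nxt y v.
  move=> wy yv; rewrite /nxt; case: pickP => [z /andP[mz /existsP]|no] //.
  by have [z yz /existsP zv] := live_step tw wy yv; have := no z; rewrite yz zv.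
have inv i : flips (enum E) w (iter i nxt x) /\ exists v, iter i nxt x v.
  elim: i => [//|i [wi vi]]; have [mi vS] := nxtP _ wi vi; split=> //.
  by rewrite -(flips_trans _ wi); apply/reach_flips/connect1.
by exists (fun i => iter i nxt x); split=> // i; case: (inv i) => wi /(nxtP _ wi)[].
Qed.

(** [recurrent] only concerns infinite paths; outside the degenerate case each nonzero reachable
    state starts one. *)
Lemma recurrent_live w y s : ~~ (all_twins && ~~ mixed w) -> reachable E w y ->
  (exists v, y v) -> recurrent E w s -> reachable E y s.
Proof.
move=> tw wy yv rw; have [pi pip] := live_path tw (reach_flips wy) yv.
by case: (pip) => <- _; apply: (recurrent_reach wy rw pip 0).
Qed.

Theorem recurrentP (w : config n) s : (exists v, w v) ->
  reflect (recurrent E w s)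
    (all_twins && ~~ mixed w || flips (enum E) w s &&
      (mixed w || if big then [exists v, ~~ s v] else #|reps s| <= (if hole then 1 else 2))).
Proof.
move=> w0; have [tw|tw] := boolP (all_twins && ~~ mixed w) => /=.
  (* The first move empties all vertices, so there is no second one. *)
  apply: ReflectT => pi [pi0 piS]; exfalso.
  case/andP: tw => /forallP tw /mixedPn mw.
  have {}tw (a b : 'I_n) : twin a b by move/forallP: (tw a).
  have wT v : w v by case: w0 => u; rewrite (mw u v).
  have eT e v : e \in E -> v \in e.
    by move=> eE; have /set0Pn[u ue] := edge0 eE; rewrite (twinP _ _ (tw v u)).
  have /moveP[e [eE _ pi1]] := piS 0.
  have /moveP[f [fE [v vf]]] := piS 1.
  by rewrite pi1 pi0 switchE wT eT.
have pi_inv pi m : infinite_path E w pi -> flips (enum E) w (pi m) /\ exists v, pi m v.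
  case=> pi0 piS; split.
    elim: m => [|m IH]; first by rewrite pi0 flips_refl.
    by rewrite -(flips_trans _ IH); apply/reach_flips/connect1.
  by have /moveP[e [_ [v _ pv] _]] := piS m; exists v.
apply: (iffP andP) => [[ws cond] pi pip m|rw].
  have [wpi pi0] := pi_inv pi m pip.
  have pis : flips (enum E) (pi m) s by rewrite (flips_trans _ wpi).
  case/orP: cond => [/existsP[u /existsP[v /andP[uv wuv]]]|]; first exact: reach_mixed uv wuv wpi pis.
  have [mw _|/mixedPn mw] := boolP (mixed w).
    by case/existsP: mw => u /existsP[v /andP[uv wuv]]; apply: reach_mixed uv wuv wpi pis.
  have cpi u v : twin u v -> pi m u = pi m v.
    move=> uv; have := flips_twin uv wpi; rewrite (mw _ _ uv) addbb.
    by case: (pi m u) (pi m v) => [] [].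
  case: ifP => [/exists_inP[a aE]|nb].
    case/card_gt2P=> u1 [u2 [u3 [[]]]]; rewrite !inE => /andP[a1 r1] /andP[a2 r2] /andP[a3 r3].
    case=> n12 n23 n31 /existsP s1.
    have tw' u v : u \in R -> v \in R -> u != v -> ~~ twin u v.
      by move=> uR vR; apply: contraNN => /(rep_uniq uR vR) ->.
    exact: reach_big aE a1 a2 a3 (tw' _ _ r1 r2 n12) (tw' _ _ r2 r3 n23) (tw' _ _ r3 r1 n31) pi0 s1 pis.
  move=> le; apply: (reach_small _ cpi pi0 le pis) => e eE; rewrite leqNgt; apply: contraFN nb => lt.
  by apply/exists_inP; exists e.
have ws : reachable E w s by apply: recurrent_live tw (connect0 _ _) w0 rw.
split; first exact: reach_flips.
have [//|/mixedPn mw /=] := boolP (mixed w).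
case: ifP => [_|nb].
  have [//|/existsPn s1] := boolP [exists v, ~~ s v]; exfalso.
  have {}s1 v : s v by have := s1 v; rewrite negbK.
  have [y wy y0] := live_step tw (flips_refl _ _) w0.
  have rws := recurrent_live tw (connect1 wy) y0 rw.
  (* A move empties some vertex, hence never ends in the full state. *)
  have full x : reachable E x s -> x = s.
    case/connectP=> p; elim: p x => [|z p IH] x //= /andP[xz zp sp].
    have zs := IH _ zp sp; case/moveP: xz => e [eE [v ve xv] ze].
    by have := s1 v; rewrite -zs ze switchE xv ve.
  have := full _ rws; have := full _ ws => ws' ys'; subst w y.
  case/moveP: wy => e [eE [v ve _] se]; have := s1 v.
  by rewrite se switchE s1 ve.
have small e : e \in E -> #|e :&: R| <= 2.
  move=> eE; rewrite leqNgt; apply: contraFN nb => lt.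
  by apply/exists_inP; exists e.
(* The number of occupied classes never increases, so any nonzero reachable [y] bounds that of
   [s]. *)
suff [y [wy y0 yle]] : exists y, [/\ reachable E w y, exists v, y v & #|reps y| <= (if hole then 1 else 2)].
  apply: leq_trans yle; apply: (reach_reps_le small); last exact: recurrent_live tw wy y0 rw.
  move=> u v uv; have := flips_twin uv (reach_flips wy); rewrite (mw _ _ uv) addbb.
  by case: (y u) (y v) => [] [].
case: w0 => v wv; have [r rR vr] := rep_ex v.
have rw' : r \in reps w by rewrite inE rR -(mw _ _ vr).
have [hl|hl] := boolP hole.
  exists (blowup [set r]); have rS : [set r] \subset R by rewrite sub1set.
  split; [|by exists r; rewrite (blowupE rS rR (twin_refl r)) set11|by rewrite reps_blowup // cards1].
  rewrite -{1}(blowup_reps mw); apply: reach_hole => //; first exact: reps_sub.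
  by rewrite cards1; apply/card_gt0P; exists r.
(* One or two classes are kept, according to parity. *)
have [S [SR Sr Sw S2 par]] : exists S : {set 'I_n},
    [/\ S \subset R, r \in S, #|S| <= #|reps w|, #|S| <= 2 & odd #|reps w| = odd #|S|].
  case par: (odd #|reps w|).
    exists [set r]; rewrite sub1set rR set11 cards1; split=> //.
    by apply/card_gt0P; exists r.
  have : 1 < #|reps w| by move: par; rewrite (cardsD1 r) rw' /=; case: #|_|.
  rewrite (cardsD1 r) rw' ltnS => /card_gt0P[t]; rewrite !inE => /and3P[tr tR wt].
  exists [set r; t]; rewrite cards2 eq_sym tr set21; split=> //.
    by rewrite subUset !sub1set rR.
  by rewrite ltnS; apply/card_gt0P; exists t; rewrite !inE tr tR.
exists (blowup S); split; last by rewrite reps_blowup.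
  by rewrite -{1}(blowup_reps mw); apply: reach_parity; rewrite ?reps_sub.
by exists r; rewrite (blowupE SR rR (twin_refl r)).
Qed.

End Process.

(** * Turing machines that sweep their tape *)

Fixpoint mealy (S A B : Type) (f : S -> A -> S * B) s v :=
  if v is a :: v' then
    let: (s1, b) := f s a in let: (s2, w) := mealy f s1 v' in (s2, b :: w)
  else (s, [::]).

Lemma mealy_cat S A B (f : S -> A -> S * B) s u v s1 u1 s2 v2 :
  mealy f s u = (s1, u1) -> mealy f s1 v = (s2, v2) -> mealy f s (u ++ v) = (s2, u1 ++ v2).
Proof.
elim: u s s1 u1 => [|a u IH] s s1 u1 /=; first by case=> <- <-.
case: (f s a) => s' b; case E: (mealy f s' u) => [s'' w] [<- <-] vE.
by rewrite (IH _ _ _ E vE).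
Qed.

Lemma size_mealy S A B (f : S -> A -> S * B) s v : size (mealy f s v).2 = size v.
Proof.
by elim: v s => [|a v IH] s //=; case: (f s a) => s' b; have := IH s'; case: mealy => s'' w /= ->.
Qed.

(** Exactly [k] steps, with no halting required at the end, so that runs can be concatenated. *)
Fixpoint steps (M : TM) k (c : tconf M) : option (tconf M) :=
  if k is k'.+1 then if tm_step c is Some c' then steps k' c' else None else Some c.

Lemma steps_add (M : TM) k j (c c' : tconf M) :
  steps k c = Some c' -> steps (k + j) c = steps j c'.
Proof. by elim: k c => [|k IH] c /=; [case=> -> | case: (tm_step c) => // c1 /IH]. Qed.

Lemma tm_run_steps (M : TM) t k (c c' : tconf M) :
  steps k c = Some c' -> tm_step c' = None -> k <= t -> tm_run t c = Some c'.
Proof.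
move=> + halt; elim: k t c => [|k IH] t c /=; first by case=> -> _; case: t => [|t] /=; rewrite halt.
by case: t => [|t] //=; case: (tm_step c) => // c1 /IH; apply.
Qed.

(* A sweep machine rewrites its input once from left to right with the transducer [ini]; then it
   alternates right-to-left passes of the transducer [stp] with idle returns, and [trn] decides at
   the left end whether a further pass follows. *)
Section SweepMachine.
Variables (I C A : finType) (i0 : I) (ini : I -> option bool -> I * A).
Variables (c0 : C) (stp : C -> A -> C * A) (trn : C -> option C) (acc : C -> bool).

(** The three kinds of states are, in order, recoding, leftward pass and idle return; blanks mark
    both ends. *)
Definition sweep_delta (q : I + C + C) (s : option (option bool + A)) :
    option ((I + C + C) * option (option bool + A) * dir) :=
  match q, s with
  | inl (inl i), Some (inl b) => let: (i', a) := ini i b in Some (inl (inl i'), Some (inr a), DR)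
  | inl (inl _), None => Some (inl (inr c0), None, DL)
  | inl (inr c), Some (inr a) => let: (c', a') := stp c a in Some (inl (inr c'), Some (inr a'), DL)
  | inl (inr c), None => if trn c is Some c' then Some (inr c', None, DR) else None
  | inr c, Some (inr a) => Some (inr c, Some (inr a), DR)
  | inr c, None => Some (inl (inr c), None, DL)
  | _, _ => None
  end.

Definition sweep_machine : TM :=
  {| tm_state := (I + C + C)%type; tm_work := A; tm_start := inl (inl i0);
     tm_delta := sweep_delta;
     tm_accept := fun q => if q is inl (inr c) then acc c else false |}.

Local Notation M := sweep_machine.

Definition cell (a : A) : tsym M := Some (inr a).

(** The tape after a move to the left; a blank is supplied when the left part is exhausted. *)
Definition pull (l r : seq (tsym M)) : seq (tsym M) * seq (tsym M) :=
  if l is b :: l' then (l', b :: r) else ([::], None :: r).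

Definition conf (q : I + C + C) (lr : seq (tsym M) * seq (tsym M)) : tconf M := (q, lr.1, lr.2).

Lemma steps_ini i l x :
  steps (size x) (conf (inl (inl i)) (l, [seq Some (inl b) | b <- x])) =
  Some (conf (inl (inl (mealy ini i x).1)) (rev (map cell (mealy ini i x).2) ++ l, [::])).
Proof.
elim: x i l => [|b x IH] i l //=; rewrite /conf /=.
case: (ini i b) => i' a /=; rewrite [steps _ _]IH.
by case: (mealy ini i' x) => i'' w /=; rewrite rev_cons cat_rcons.
Qed.

Lemma steps_left c v l r :
  steps (size v) (conf (inl (inr c)) (pull (map cell v ++ l) r)) =
  Some (conf (inl (inr (mealy stp c v).1)) (pull l (rev (map cell (mealy stp c v).2) ++ r))).
Proof.
elim: v c r => [|a v IH] c r //=; rewrite /conf /=.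
case: (stp c a) => c' a' /=.
rewrite (_ : match _ with [::] => _ | _ => _ end = Some (conf (inl (inr c')) (pull (map cell v ++ l) (cell a' :: r)))).
  rewrite IH; case: (mealy stp c' v) => c'' w /=; by rewrite rev_cons cat_rcons.
by case: (map cell v ++ l).
Qed.

Lemma steps_back c v l r :
  steps (size v) (conf (inr c) (l, map cell v ++ r)) =
  Some (conf (inr c) (rev (map cell v) ++ l, r)).
Proof.
by elim: v l => [|a v IH] l //=; rewrite /conf /= [steps _ _]IH rev_cons cat_rcons.
Qed.

(** [v] lists the cells from right to left, so the output of one pass is directly the input of the
    next. *)
Fixpoint sweeps t c v : option C :=
  let: (c', v') := mealy stp c v in
  if trn c' is Some c'' then if t is t'.+1 then sweeps t' c'' v' else None else Some c'.

Lemma step_pull c (l : seq (tsym M)) r : l = [::] \/ l = [:: None] ->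
  conf (inl (inr c)) (pull l r) = conf (inl (inr c)) ([::], None :: r).
Proof. by case=> ->. Qed.

Lemma steps_sweeps t c v l c' : l = [::] \/ l = [:: None] -> sweeps t c v = Some c' ->
  exists k cf, [/\ k <= t.+1 * (size v).*2.+2,
    steps k (conf (inl (inr c)) (pull (map cell v ++ l) [:: None])) = Some cf,
    tm_step cf = None & cf.1.1 = inl (inr c')].
Proof.
elim: t c v l => [|t IH] c v l lN /=; have := steps_left c v l [:: None]; have := size_mealy stp c v;
  case: (mealy stp c v) => c1 v1 /= sz; rewrite (step_pull c1 _ lN) => st; case E: (trn c1) => [c2|] // h.
- case: h => <-; exists (size v), (conf (inl (inr c1)) ([::], None :: (rev (map cell v1) ++ [:: None]))).
  by split=> //=; rewrite ?E // mul1n -addnn -!addnS leq_addr.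
- have [k [cf [le sk halt cfE]]] := IH c2 v1 [:: None] (or_intror erefl) h.
  (* A pass, a turn, the return and another turn precede the remaining [k] steps. *)
  exists (size v + (1 + (size v + (1 + k)))), cf; split=> //.
    rewrite !add1n !addnS addnA addnn -!addSn; rewrite sz in le; exact: (leq_add (leqnn (size v).*2.+2) le).
  rewrite (steps_add _ st) add1n /= E -[(_, _, _)]/(conf (inr c2) ([:: None], rev (map cell v1) ++ [:: None])).
  rewrite -map_rev; have := steps_back c2 (rev v1) [:: None] [:: None].
  rewrite size_rev sz map_rev revK => sb; rewrite (steps_add _ sb) add1n /=.
  by rewrite -sk; case: (map cell v1 ++ [:: None]).
- case: h => <-; exists (size v), (conf (inl (inr c1)) ([::], None :: (rev (map cell v1) ++ [:: None]))).
  split=> //=; rewrite ?E // mulSn; apply: leq_trans (leq_addr _ _).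
  by rewrite -addnn -!addnS leq_addr.
Qed.

Lemma sweep_machine_run x t T c' :
  sweeps t c0 (rev (mealy ini i0 x).2) = Some c' ->
  (size x).+1 + t.+1 * (size x).*2.+2 <= T ->
  exists cf : tconf M, tm_run T (tm_init M x) = Some cf /\ @tm_accept M cf.1.1 = acc c'.
Proof.
move=> sw leT; have [k [cf [le sk halt cfE]]] := steps_sweeps (or_introl erefl) sw.
exists cf; rewrite cfE; split=> //; apply: (@tm_run_steps _ _ (size x + (1 + k)) _ _ _ halt); last first.
  by rewrite size_rev size_mealy in le; apply: leq_trans leT; rewrite addnA addn1 leq_add2l.
have := steps_ini i0 [::] x => si.
have -> : tm_init M x = conf (inl (inl i0)) ([::], [seq Some (inl b) | b <- x]) by [].
rewrite (steps_add _ si) add1n /=; rewrite -sk map_rev.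
by case: (rev _ ++ [::]).
Qed.

End SweepMachine.

(** * The decision algorithm *)

Lemma has_iotaS (P : pred nat) t : has P (iota 0 t.+1) = has P (iota 0 t) || P t.
Proof. by rewrite -addn1 iotaD has_cat /= orbF. Qed.

Lemma all_iotaS (P : pred nat) t : all P (iota 0 t.+1) = all P (iota 0 t) && P t.
Proof. by rewrite -addn1 iotaD all_cat /= andbT. Qed.

Lemma count_iotaS (P : pred nat) t : count P (iota 0 t.+1) = count P (iota 0 t) + P t.
Proof. by rewrite -addn1 iotaD count_cat /= addn0. Qed.

Lemma mealy_iota (S A B : Type) (f : S -> A -> S * B) (g : nat -> S) (a : nat -> A) (b : nat -> B) n :
  (forall t, t < n -> f (g t) (a t) = (g t.+1, b t)) ->
  mealy f (g 0) (map a (iota 0 n)) = (g n, map b (iota 0 n)).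
Proof.
elim: n => [|n IH] st //; rewrite -addn1 iotaD !map_cat.
apply: mealy_cat; first by apply: IH => t tn; apply: st; apply: ltnW.
by rewrite /= add0n st // addn1.
Qed.

(* A header carries the kind of its row ([None]: hyperedge, [Some false]: w2, [Some true]: w1) and
   whether the row has served as pivot. An entry (b, m1, m2, nr) carries its bit and three marks:
   [m1] for the columns treated in the inner loop, [m2] for those treated in the outer loop (during
   the elimination: the bit that was in the pivot column), [nr] for the columns that have an earlier
   twin. *)
Definition header := (option bool * bool)%type.
Definition entry := (bool * bool * bool * bool)%type.
Definition letter := (header + entry)%type.

Definition tape m n (h : nat -> header) (c : nat -> nat -> entry) : seq letter :=
  flatten [seq inl (h q) :: [seq inr (c q t) | t <- iota 0 n] | q <- iota 0 m].

(** Invariant rule for a pass: [g q t] is the state in front of entry [t] of row [q], and a header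
    is read in the last state of the preceding row. *)
Lemma mealy_tape (S : Type) (f : S -> letter -> S * letter) m n h c h' c' (s : S) (g : nat -> nat -> S) :
  (forall q, q < m -> f (if q is q'.+1 then g q' n else s) (inl (h q)) = (g q 0, inl (h' q))) ->
  (forall q t, q < m -> t < n -> f (g q t) (inr (c q t)) = (g q t.+1, inr (c' q t))) ->
  mealy f s (tape m n h c) = (if m is m'.+1 then g m' n else s, tape m n h' c').
Proof.
rewrite /tape; elim: m => [|m IH] hd ce //; rewrite -addn1 iotaD !map_cat !flatten_cat.
apply: mealy_cat.
  by apply: IH => [q qm|q t qm]; [apply: hd; apply: ltnW|apply: ce; apply: ltnW].
rewrite /= !cats0 add0n hd // (@mealy_iota _ _ _ f (g m) _ (fun t => inr (c' m t)) n) ?addn1 //.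
by move=> t; apply: ce.
Qed.

Lemma eq_tape m n h c h' c' :
  (forall q, q < m -> h q = h' q) -> (forall q t, q < m -> t < n -> c q t = c' q t) ->
  tape m n h c = tape m n h' c'.
Proof.
move=> eh ec; congr flatten; apply/eq_in_map=> q; rewrite mem_iota => qm.
rewrite eh //; congr cons; apply/eq_in_map=> t; rewrite mem_iota => tn.
by rewrite ec.
Qed.

Lemma size_tape m n h c : size (tape m n h c) = m * n.+1.
Proof.
rewrite /tape size_flatten /shape -map_comp -[m in RHS](size_iota 0).
by elim: (iota 0 m) => [|q s IH] //=; rewrite size_map size_iota IH mulSn.
Qed.

Inductive control :=
  | Compare of bool & bool & bool & bool & bool & bool
  | Advance of bool & bool & bool & bool & bool
  | NextColumn of bool & bool & bool
  | Count of bool & bool & bool & bool & bool & bool & bool & bool & bool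
  | Eliminate of bool & bool & bool & option bool & bool & bool & bool & bool & bool & bool & bool
  | NextRow of bool & bool & bool.

Definition control_code (c : control) :
    bool * bool * bool * bool * bool * bool + bool * bool * bool * bool * bool + bool * bool * bool +
    bool * bool * bool * bool * bool * bool * bool * bool * bool +
    bool * bool * bool * option bool * bool * bool * bool * bool * bool * bool * bool + bool * bool * bool :=
  match c with
  | Compare a b c d e f => inl (inl (inl (inl (inl (a, b, c, d, e, f)))))
  | Advance a b c d e => inl (inl (inl (inl (inr (a, b, c, d, e)))))
  | NextColumn a b c => inl (inl (inl (inr (a, b, c))))
  | Count a b c d e f g h i => inl (inl (inr (a, b, c, d, e, f, g, h, i)))
  | Eliminate a b c d e f g h i j k => inl (inr (a, b, c, d, e, f, g, h, i, j, k))
  | NextRow a b c => inr (a, b, c)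
  end.

Definition control_decode x :=
  match x with
  | inl (inl (inl (inl (inl (a, b, c, d, e, f))))) => Compare a b c d e f
  | inl (inl (inl (inl (inr (a, b, c, d, e))))) => Advance a b c d e
  | inl (inl (inl (inr (a, b, c)))) => NextColumn a b c
  | inl (inl (inr (a, b, c, d, e, f, g, h, i))) => Count a b c d e f g h i
  | inl (inr (a, b, c, d, e, f, g, h, i, j, k)) => Eliminate a b c d e f g h i j k
  | inr (a, b, c) => NextRow a b c
  end.

Lemma control_codeK : cancel control_code control_decode.
Proof. by case. Qed.

HB.instance Definition _ := Finite.copy control (can_type control_codeK).

Definition start_compare al mx := Compare al mx true false false false.
Definition start_eliminate yes cond found :=
  Eliminate yes cond found None false false false false false false false.

Definition pass (s : control) (x : letter) : control * letter :=
  match s, x with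
  (* [Compare al mx tw d su sv] compares the columns u, v, the first ones with [m2] and [m1] unset:
     [su], [sv] tell whether they were met in this row, [d] is the sum of their bits and [tw] tells
     whether they agree on all earlier hyperedges. [al]: all pairs so far are twins; [mx]: some
     pair of twins was separated by w1. *)
  | Compare al mx tw d _ _, inl (ty, _) =>
      (Compare al mx (if ty is Some true then tw else tw && ~~ d) false false false, x)
  | Compare al mx tw d su sv, inr (b, m1, m2, nr) =>
      (Compare al mx tw (d (+) (b && ~~ m2 && ~~ su) (+) (b && ~~ m1 && ~~ sv))
         (su || ~~ m2) (sv || ~~ m1), x)
  | Advance al mx tw _ _, inl _ => (Advance al mx tw false false, x)
  | Advance al mx tw su sv, inr (b, m1, m2, nr) =>
      (Advance al mx tw (su || ~~ m2) (sv || ~~ m1),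
       inr (b, m1 || ~~ sv, m2, nr || [&& tw, su, ~~ m1 & ~~ sv]))
  | NextColumn al mx _, inl _ => (NextColumn al mx false, x)
  | NextColumn al mx su, inr (b, m1, m2, nr) =>
      (NextColumn al mx (su || ~~ m2), inr (b, false, m2 || ~~ su, nr))
  (* [g1], [g2], [g3]: at least 1, 2, 3 representatives with bit 1 so far in this row; [one]: only
     ones so far. *)
  | Count al mx bg hl g1 g2 g3 one cond, inl (ty, _) =>
      (if ty is Some true then
         Count al mx bg hl false false false true
           (mx || (if bg then ~~ one else if hl then ~~ g2 else ~~ g3))
       else Count al mx (bg || g3) (hl || g1 && ~~ g2) false false false true cond, x)
  | Count al mx bg hl g1 g2 g3 one cond, inr (b, m1, m2, nr) =>
      let r := b && ~~ nr in
      (Count al mx bg hl (g1 || r) (g2 || g1 && r) (g3 || g2 && r) (one && b) cond,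
       inr (b, false, false, false))
  (* [st] is [None] before, [Some false] on and [Some true] after the pivot row. The current column
     is the first one with [m1] unset ([cd]: already met in this row, [active]: exists); [carry] is
     its bit in the pivot row and [piv] tells whether it is the pivot column. [fl] tells whether the
     present row has to be reduced. With [force], the pivot row is w2, which is added to w1. *)
  | Eliminate yes cond found st carry piv force _ _ active _, inl (ty, done) =>
      (if st is None then
         if ty is Some _ then Eliminate yes cond found (Some false) carry piv true false false active false
         else if done then s
         else Eliminate yes cond found (Some false) carry piv false false false active false
       else Eliminate yes cond found (Some true) carry piv force false false active false, x)
  | Eliminate yes cond found None _ _ _ _ _ _ _, inr _ => (s, x)
  | Eliminate yes cond found (Some false) carry piv force fl cd active nz, inr (b, m1, m2, nr) =>
      if m1 || cd then (s, x) else
      (Eliminate yes cond (found || b) (Some false) b (b && ~~ found) force fl true true nz,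
       inr (b, true, m2, nr))
  | Eliminate yes cond found (Some true) carry piv force fl cd active nz, inr (b, m1, m2, nr) =>
      if m1 then (Eliminate yes cond found (Some true) carry piv force (fl || m2) cd active (nz || b), x)
      else if cd then (Eliminate yes cond found (Some true) carry piv force fl cd active (nz || b), x)
      else let fl' := fl || piv && b in let b' := b (+) (carry && (force || fl')) in
        (Eliminate yes cond found (Some true) carry piv force fl' true active (nz || b'),
         inr (b', true, piv && b, nr))
  | NextRow yes cond passed, inl (ty, done) =>
      if passed || done || (ty != None) then (s, x) else (NextRow yes cond true, inl (ty, true))
  | NextRow yes cond passed, inr (b, m1, m2, nr) =>
      (s, if passed then inr (b, false, false, nr) else x)
  end.

Definition turn (s : control) : option control :=
  match s with
  | Compare al mx tw d su sv => Some (
      if ~~ su then Count al mx false false false false false true false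
      else if ~~ sv then NextColumn al mx false
      else Advance (al && tw) (mx || tw && d) tw false false)
  | Advance al mx _ _ _ => Some (start_compare al mx)
  | NextColumn al mx _ => Some (start_compare al mx)
  | Count al mx _ _ _ _ _ _ cond => Some (start_eliminate (al && ~~ mx) cond false)
  | Eliminate yes cond found _ _ _ force _ _ active _ =>
      if active then Some (start_eliminate yes cond found)
      else if force then None else Some (NextRow yes cond false)
  | NextRow yes cond _ => Some (start_eliminate yes cond false)
  end.

(** [nz] is reset at each header, so at the end it refers to the row of w1, after the forced
    addition of w2. *)
Definition accept (s : control) :=
  if s is Eliminate yes cond _ _ _ _ _ _ _ _ nz then yes || cond && ~~ nz else false.

(** A separator becomes the header of the word it closes, since passes read from the right. The
    state is the kind of the current row. *)
Definition convert (i : option bool) (s : option bool) : option bool * letter :=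
  match s with
  | Some b => (i, inr (b, false, false, false))
  | None => (if i is Some true then Some false else None, inl (i, false))
  end.

Notation run := (sweeps pass turn).

Lemma run_step k c v c' v' c'' : mealy pass c v = (c', v') -> turn c' = Some c'' ->
  run k.+1 c v = run k c'' v'.
Proof. by move=> /= -> ->. Qed.

Lemma run_halt k c v c' v' : mealy pass c v = (c', v') -> turn c' = None -> run k c v = Some c'.
Proof. by case: k => [|k] /= -> ->. Qed.

Arguments sweeps : simpl never.

(** * Comparing columns and counting representatives *)

Section Algorithm.
Variables m n : nat.
Implicit Types (r M : nat -> nat -> bool) (nr : nat -> bool).

(** Hyperedges come first, then w2 as row [m] and w1 as row [m.+1]. *)
Definition kind q := if q < m then None else Some (m < q).

Lemma kind_edge q : q < m -> kind q = None.
Proof. by rewrite /kind => ->. Qed.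

Lemma kind_w2 : kind m = Some false.
Proof. by rewrite /kind ltnn. Qed.

Lemma kind_w1 : kind m.+1 = Some true.
Proof. by rewrite /kind ltnNge leqnSn ltnSn. Qed.

Lemma kind_le q : q <= m -> (kind q == Some true) = false.
Proof. by rewrite /kind leqNgt => /negbTE ->; case: ifP. Qed.

Definition col_twin r u v := all (fun q => r q u == r q v) (iota 0 m).

(** [k] is the current outer column and [i] the inner one; the value [n] means that none is left. *)
Definition pair_tape r i k nr :=
  tape m.+2 n (fun q => (kind q, false)) (fun q t => (r q t, t < i, t < k, nr t)).

Lemma compare_pass r i k nr al mx : i <= n -> k <= n ->
  mealy pass (start_compare al mx) (pair_tape r i k nr) =
  (Compare al mx (all (fun q => ((k < n) && r q k) == ((i < n) && r q i)) (iota 0 m)) 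
      (((k < n) && r m.+1 k) (+) ((i < n) && r m.+1 i)) (k < n) (i < n), pair_tape r i k nr).
Proof.
(* The agreement on a row is recorded at the next header; [minn] keeps the rows of w2 and w1 out of
   the twin test. *)
move=> le_in le_kn; pose g q t := Compare al mx
  (all (fun q => ((k < n) && r q k) == ((i < n) && r q i)) (iota 0 (minn q m)))
  (((k < t) && r q k) (+) ((i < t) && r q i)) (k < t) (i < t).
rewrite /pair_tape (@mealy_tape _ pass m.+2 n _ _ (fun q => (kind q, false))
   (fun q t => (r q t, t < i, t < k, nr t)) _ g).
- by rewrite /g (minn_idPr _).
- move=> q qm; rewrite /g /start_compare; case: q qm => [|q] qm.
    by rewrite min0n; have := kind_le (leq0n m); case: (kind 0) => [[]|].
  rewrite [LHS]/=; congr (Compare _ _ _ _ _ _, _).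
  have [le|gt] := leqP q.+1 m.
    rewrite (minn_idPl (ltnW le)) all_iotaS; have := kind_le le.
    by case: (kind _) => [[]|] // _; case: ((k < n) && r q k) ((i < n) && r q i) => [] [].
  have -> : q = m by apply/eqP; rewrite eqn_leq; apply/andP; split.
  by rewrite kind_w1 minnn.
- move=> q t qm tn; rewrite /g /=; congr (Compare _ _ _ _ _ _, _).
  + rewrite !ltnS.
    by case: (ltngtP t i) => [ti|ti|<-]; case: (ltngtP t k) => [tk|tk|<-];
     rewrite ?andbT ?andbF ?addbF ?addFb ?andTb //; case: (r q _); case: (r q _).
  + by rewrite ltnS; case: ltngtP.
  + by rewrite ltnS; case: ltngtP.
Qed.

Lemma advance_pass r i k nr al mx tw : 
  exists su sv, mealy pass (Advance al mx tw false false) (pair_tape r i k nr) =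
    (Advance al mx tw su sv, pair_tape r i.+1 k (fun t => nr t || [&& t == i, tw & k < t])).
Proof.
pose g (q t : nat) := Advance al mx tw (k < t) (i < t).
exists (k < n), (i < n); rewrite /pair_tape (@mealy_tape _ pass m.+2 n _ _ (fun q => (kind q, false))
   (fun q t => (r q t, t < i.+1, t < k, nr t || [&& t == i, tw & k < t])) _ g) //.
- by case=> [|q] qm /=; case: (kind _).
- move=> q t qm tn; rewrite /g /= !ltnS -!leqNgt.
  by case: (ltngtP t i) => [ti|ti|ti]; case: (ltngtP t k) => [tk|tk|tk];
    rewrite ?andbT ?andbF ?orbF ?andTb //=.
Qed.

Lemma next_column_pass r i k nr al mx : 
  exists su, mealy pass (NextColumn al mx false) (pair_tape r i k nr) =
    (NextColumn al mx su, pair_tape r 0 k.+1 nr).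
Proof.
pose g (q t : nat) := NextColumn al mx (k < t).
exists (k < n); rewrite /pair_tape (@mealy_tape _ pass m.+2 n _ _ (fun q => (kind q, false))
   (fun q t => (r q t, t < 0, t < k.+1, nr t)) _ g) //.
- by case=> [|q] qm /=; case: (kind _).
- move=> q t qm tn; rewrite /g /= !ltnS -!leqNgt.
  by case: (ltngtP t k) => [tk|tk|tk]; rewrite ?orbT ?orbF //=.
Qed.

Section Pairs.
Variable r : nat -> nat -> bool.

Definition twins_upto k i :=
  all (fun u => all (col_twin r u) (iota 0 n)) (iota 0 k) && all (col_twin r k) (iota 0 i).
Definition mixed_pair u v := col_twin r u v && (r m.+1 u (+) r m.+1 v).
Definition mixed_upto k i :=
  has (fun u => has (mixed_pair u) (iota 0 n)) (iota 0 k) || has (mixed_pair k) (iota 0 i).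
Definition nonrep_upto k i t :=
  has (fun u => col_twin r u t && (u < t)) (iota 0 k) || [&& t < i, col_twin r k t & k < t].

Lemma run_pair c k i : k < n -> i < n ->
  run c.+2 (start_compare (twins_upto k i) (mixed_upto k i)) (pair_tape r i k (nonrep_upto k i)) =
  run c (start_compare (twins_upto k i.+1) (mixed_upto k i.+1))
    (pair_tape r i.+1 k (nonrep_upto k i.+1)).
Proof.
move=> kn ni; have cmp := compare_pass r (nonrep_upto k i) (twins_upto k i) (mixed_upto k i) (ltnW ni) (ltnW kn).
rewrite (run_step _ cmp (erefl _)) kn ni /=.
have -> : all (fun q => r q k == r q i) (iota 0 m) = col_twin r k i by [].
have [su [sv adv]] := advance_pass r i k (nonrep_upto k i) (twins_upto k i && col_twin r k i)
  (mixed_upto k i || col_twin r k i && (r m.+1 k (+) r m.+1 i)) (col_twin r k i).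
rewrite (run_step _ adv (erefl _)) /twins_upto /mixed_upto all_iotaS has_iotaS orbA andbA.
congr (run _ _ _); apply: eq_tape => // q t qm tn; congr (_, _, _, _).
rewrite /nonrep_upto ltnS -orbA; congr (_ || _).
by case: (ltngtP t i) => [ti|ti|->]; rewrite ?orbF.
Qed.

(** Two passes for each inner column, one comparison that finds none left, and [NextColumn]. *)
Lemma run_column c k : k < n ->
  run (c + n.*2.+2) (start_compare (twins_upto k 0) (mixed_upto k 0)) (pair_tape r 0 k (nonrep_upto k 0)) =
  run c (start_compare (twins_upto k.+1 0) (mixed_upto k.+1 0))
    (pair_tape r 0 k.+1 (nonrep_upto k.+1 0)).
Proof.
move=> kn; have loop i d : i <= n ->
    run (d + i.*2) (start_compare (twins_upto k 0) (mixed_upto k 0)) (pair_tape r 0 k (nonrep_upto k 0)) =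
    run d (start_compare (twins_upto k i) (mixed_upto k i)) (pair_tape r i k (nonrep_upto k i)).
  elim: i d => [|i IH] d ni; first by rewrite addn0.
  by rewrite doubleS !addnS -!addSn IH ?run_pair // ltnW.
rewrite !addnS -!addSn loop //.
have cmp := compare_pass r (nonrep_upto k n) (twins_upto k n) (mixed_upto k n) (leqnn n) (ltnW kn).
rewrite (run_step _ cmp (erefl _)) kn ltnn /=.
have [su nxt] := next_column_pass r n k (nonrep_upto k n) (twins_upto k n) (mixed_upto k n).
rewrite (run_step _ nxt (erefl _)) /twins_upto /mixed_upto all_iotaS has_iotaS orbF andbT.
congr (run _ _ _); apply: eq_tape => // q t qm tn; congr (_, _, _, _).
by rewrite /nonrep_upto has_iotaS tn orbF.
Qed.

Definition all_col_twins := all (fun u => all (col_twin r u) (iota 0 n)) (iota 0 n).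
Definition some_mixed_pair := has (fun u => has (mixed_pair u) (iota 0 n)) (iota 0 n).
Definition nonrep t := has (fun u => col_twin r u t && (u < t)) (iota 0 n).

Lemma run_pairs c :
  run (c + (n * n.*2.+2).+1) (start_compare true false) (pair_tape r 0 0 xpred0) =
  run c (Count all_col_twins some_mixed_pair false false false false false true false)
    (pair_tape r 0 n nonrep).
Proof.
have loop k d : k <= n ->
    run (d + k * n.*2.+2) (start_compare true false) (pair_tape r 0 0 xpred0) =
    run d (start_compare (twins_upto k 0) (mixed_upto k 0)) (pair_tape r 0 k (nonrep_upto k 0)).
  elim: k d => [|k IH] d nk; first by rewrite addn0.
  by rewrite mulSn addnA IH ?run_column // ltnW.
rewrite addnS -addSn loop //.
have cmp := compare_pass r (nonrep_upto n 0) (twins_upto n 0) (mixed_upto n 0) (leq0n n) (leqnn n).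
rewrite (run_step _ cmp (erefl _)) ltnn /= /twins_upto /mixed_upto orbF andbT.
by congr (run _ _ _); apply: eq_tape => // q t qm tn; rewrite /nonrep_upto orbF.
Qed.

Definition rep_count q := count (fun t => r q t && ~~ nonrep t) (iota 0 n).
Definition some_big := has (fun q => 2 < rep_count q) (iota 0 m).
Definition some_hole := has (fun q => rep_count q == 1) (iota 0 m).
Definition extra_condition := some_mixed_pair ||
  if some_big then ~~ all (r m) (iota 0 n) else rep_count m <= (if some_hole then 1 else 2).

Definition bit_tape M p := tape m.+2 n (fun q => (kind q, q < p)) (fun q t => (M q t, false, false, false)).

Lemma run_count c al k i : 
  run c.+1 (Count al some_mixed_pair false false false false false true false) (pair_tape r i k nonrep) =
  run c (start_eliminate (al && ~~ some_mixed_pair) extra_condition false) (bit_tape r 0).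
Proof.
pose cnt q t := count (fun t => r q t && ~~ nonrep t) (iota 0 t).
(* The condition on w2 is evaluated at the header of w1, hence the guard [m < q]. *)
pose g q t := Count al some_mixed_pair
  (has (fun q => 2 < rep_count q) (iota 0 (minn q m))) (has (fun q => rep_count q == 1) (iota 0 (minn q m)))
  (0 < cnt q t) (1 < cnt q t) (2 < cnt q t) (all (r q) (iota 0 t)) ((m < q) && extra_condition).
rewrite (@run_step _ _ _ (g m.+1 n) (bit_tape r 0) (start_eliminate (al && ~~ some_mixed_pair) extra_condition false)) //.
  rewrite /pair_tape (@mealy_tape _ pass m.+2 n _ _ (fun q => (kind q, false))
     (fun q t => (r q t, false, false, false)) _ g) //.
  - move=> q qm; rewrite /g; case: q qm => [|q] qm.
      by rewrite min0n; have := kind_le (leq0n m); case: (kind 0) => [[]|].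
    rewrite [LHS]/=; congr (_, _).
    have [le|gt] := leqP q.+1 m.
      rewrite (minn_idPl (ltnW le)) !has_iotaS; have := kind_le le.
      rewrite (ltnNge m q) (ltnW le) /=.
      case: (kind _) => [[]|] // _; congr (Count _ _ _ _ _ _ _ _ _).
        by congr (_ || _); rewrite /rep_count -/(cnt q n); case: (cnt q n) => [|[|]].
      by congr (_ || _); rewrite /rep_count -/(cnt q n); case: (cnt q n) => [|[|]].
    have -> : q = m by apply/eqP; rewrite eqn_leq; apply/andP; split.
    rewrite kind_w1 minnn /=; congr (Count _ _ _ _ _ _ _ _ _).
    by rewrite /extra_condition -/some_big -/some_hole -!leqNgt /rep_count -/(cnt m n); case: some_hole.
  - move=> q t qm tn; rewrite /g all_iotaS /cnt count_iotaS [LHS]/=; congr (Count _ _ _ _ _ _ _ _ _, _);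
    by case: (r q t && ~~ nonrep t); rewrite ?addn1 ?addn0 ?orbT ?orbF ?andbT ?andbF //=; case: (count _ _) => [|[|[|]]].
by rewrite /= ltnSn.
Qed.

End Pairs.

(** * Gaussian elimination on the tape *)

Definition first_one M p t := M p t && ~~ has (M p) (iota 0 t).
Definition pivot_bit M p q t := has (fun s => first_one M p s && M q s) (iota 0 t).
(** The pivot row is added to rows with a 1 in the pivot column, and for [p == m] without condition.
    Inspecting only columns up to [t] allows one column at a time to be treated. *)
Definition reduce M p q t := M q t (+) (M p t && ((p == m) || pivot_bit M p q t.+1)).

(** [J] stands for the finished rows, which later passes copy unchanged; [i] columns have been
    treated. *)
Definition elim_entry (J : nat -> nat -> entry) M p i q t : entry :=
  if q < p then J q t
  else if q == p then (M p t, t < i, false, false)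
  else (if t < i then reduce M p q t else M q t, t < i, [&& t < i, first_one M p t & M q t], false).

Definition elim_tape J M p i := tape m.+2 n (fun q => (kind q, q < p)) (elim_entry J M p i).

Lemma eliminate_pass J M p i yes cond : p <= m -> i <= n -> exists carry piv fl cd,
  mealy pass (start_eliminate yes cond (has (M p) (iota 0 i))) (elim_tape J M p i) =
  (Eliminate yes cond (has (M p) (iota 0 (minn n i.+1))) (Some true) carry piv (p == m) fl cd (i < n)
     (has (fun t => (elim_entry J M p i.+1 m.+1 t).1.1.1) (iota 0 n)), elim_tape J M p i.+1).
Proof.
move=> pm le_in.
pose g q t :=
  if q < p then start_eliminate yes cond (has (M p) (iota 0 i))
  else if q == p then
    Eliminate yes cond (has (M p) (iota 0 (if i < t then i.+1 else i))) (Some false) ((i < t) && M p i)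
      ((i < t) && first_one M p i) (p == m) false (i < t) (i < t) false
  else Eliminate yes cond (has (M p) (iota 0 (minn n i.+1))) (Some true) ((i < n) && M p i)
      ((i < n) && first_one M p i) (p == m) (pivot_bit M p q (minn t i.+1)) (i < t) (i < n)
      (has (fun t => (elim_entry J M p i.+1 q t).1.1.1) (iota 0 t)).
exists ((i < n) && M p i), ((i < n) && first_one M p i), (pivot_bit M p m.+1 (minn n i.+1)), (i < n).
rewrite /elim_tape (@mealy_tape _ pass m.+2 n _ _ (fun q => (kind q, q < p)) (elim_entry J M p i.+1) _ g).
- by rewrite /g ltnNge ltnW ?ltnS // gtn_eqF.
- move=> q qm; rewrite /g.
  have [qp|pq|->] := ltngtP q p.
  + rewrite kind_edge ?(leq_trans qp) //.
    by case: q qp {qm} => [|q] qp //=; rewrite (ltnW qp).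
  + case: q pq qm => [//|q]; rewrite ltnS => pq qm.
    rewrite ltnNge pq min0n ltn0 /=; case: eqVneq => [_|_] //=.
    by case: (ltngtP n i) le_in => // [lt|->] _; rewrite ?(minn_idPr lt) ?(minn_idPl (leqnSn _)).
  + have -> : (if p is q'.+1 then if q' < p then start_eliminate yes cond (has (M p) (iota 0 i))
        else if q' == p then
          Eliminate yes cond (has (M p) (iota 0 (if i < n then i.+1 else i))) (Some false)
            ((i < n) && M p i) ((i < n) && first_one M p i) (p == m) false (i < n) (i < n) false
        else Eliminate yes cond (has (M p) (iota 0 (minn n i.+1))) (Some true) ((i < n) && M p i)
            ((i < n) && first_one M p i) (p == m) (pivot_bit M p q' (minn n i.+1)) (i < n) (i < n)
            (has (fun t => (elim_entry J M p i.+1 q' t).1.1.1) (iota 0 n))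
        else start_eliminate yes cond (has (M p) (iota 0 i))) = start_eliminate yes cond (has (M p) (iota 0 i)).
      by clear g pm; case: p => [|p'] //; rewrite ltnSn.
    rewrite ltn0 /=; have [->|pNm] := eqVneq p m; first by rewrite kind_w2.
    by rewrite kind_edge // ltn_neqAle pNm.
- move=> q t qm tn; rewrite /g.
  case: (ltngtP q p) => [qp|pq|->].
  + by rewrite /elim_entry qp.
  + have eE k : elim_entry J M p k q t =
        (if t < k then reduce M p q t else M q t, t < k, [&& t < k, first_one M p t & M q t], false).
      by rewrite /elim_entry ltnNge (ltnW pq) /= gtn_eqF.
    rewrite has_iotaS !eE; set nz := has _ (iota 0 t); rewrite !ltnS [LHS]/=.
    have pS k : pivot_bit M p q k.+1 = pivot_bit M p q k || first_one M p k && M q k by apply: has_iotaS.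
    case: (ltngtP t i) => [ti|ti|ti] /=.
    * rewrite (minn_idPl (leqW (ltnW ti))) (minn_idPl (leqW ti)).
      by rewrite pS.
    * by rewrite (minn_idPr ti) (minn_idPr (leqW ti)).
    * by rewrite /reduce ti in tn *; rewrite minnn (minn_idPl (leqnSn i)) pS tn.
  rewrite /elim_entry ltnn eqxx !ltnS.
  case: (ltngtP t i) => [ti|ti|->] //=; rewrite ?andbF //.
  by rewrite -(has_iotaS (M p)).
Qed.

Lemma next_row_pass J M p yes cond : p < m -> exists J',
  mealy pass (NextRow yes cond false) (elim_tape J M p n) =
  (NextRow yes cond true, elim_tape J' (reduce M p) p.+1 0).
Proof.
move=> pm; pose J' q t := if q < p then J q t else (M p t, false, false, false); exists J'.
pose g (q t : nat) := NextRow yes cond (p <= q).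
rewrite /elim_tape (@mealy_tape _ pass m.+2 n _ _ (fun q => (kind q, q < p.+1))
  (elim_entry J' (reduce M p) p.+1 0) _ g).
- by rewrite /g ltnW // ltnW.
- move=> q qm; rewrite /g; have -> : (if q is q'.+1 then NextRow yes cond (p <= q') else NextRow yes cond false) =
      NextRow yes cond (p < q) by case: q {qm}.
  by rewrite ltnS /=; case: (ltngtP q p) => [qp|qp|qp] //=; rewrite kind_edge // qp.
- move=> q t qm tn; rewrite /g /elim_entry ltnS /J'; case: (ltngtP q p) => [qp|qp|qp] //=.
  - by case: (J q t) => [[[]]].
  - by rewrite tn ltn0; case: ifP => [/eqP ->|].
Qed.

Lemma run_eliminate_columns J M p i yes cond c : p <= m -> i <= n ->
  run (c + i) (start_eliminate yes cond false) (elim_tape J M p 0) =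
  run c (start_eliminate yes cond (has (M p) (iota 0 i))) (elim_tape J M p i).
Proof.
move=> pm; elim: i c => [|i IH] c ni; first by rewrite addn0.
rewrite addnS -addSn IH ?(ltnW ni) //.
have [carry [piv [fl [cd el]]]] := eliminate_pass J M yes cond pm (ltnW ni).
by rewrite ni (minn_idPr ni) in el; rewrite (run_step _ el (erefl _)).
Qed.

(** [n] passes treat the columns, one finds none left, and [NextRow] retires the pivot row. *)
Lemma run_eliminate_row J M p yes cond c : p < m -> exists J',
  run (c + n.+2) (start_eliminate yes cond false) (elim_tape J M p 0) =
  run c (start_eliminate yes cond false) (elim_tape J' (reduce M p) p.+1 0).
Proof.
move=> pm; have [J' nxt] := next_row_pass J M yes cond pm; exists J'.
rewrite !addnS -!addSn run_eliminate_columns // 1?ltnW //.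
have [carry [piv [fl [cd el]]]] := eliminate_pass J M yes cond (ltnW pm) (leqnn n).
rewrite ltnn (ltn_eqF pm) in el; rewrite (run_step _ el (erefl _)).
have same : elim_tape J M p n.+1 = elim_tape J M p n.
  by apply: eq_tape => // q t _ tn; rewrite /elim_entry !ltnS tn (ltnW tn).
by rewrite same (run_step _ nxt (erefl _)).
Qed.

Fixpoint eliminated M p := if p is p'.+1 then reduce (eliminated M p') p' else M.

Lemma run_eliminate M yes cond c : exists2 s,
  run (c + (n + m * n.+2)) (start_eliminate yes cond false) (bit_tape M 0) = Some s &
  accept s = yes || cond && all (fun t => eliminated M m m.+1 t == eliminated M m m t) (iota 0 n).
Proof.
pose J0 := fun (_ _ : nat) => (false, false, false, false).
have -> : bit_tape M 0 = elim_tape J0 M 0 0.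
  by apply: eq_tape => // q t _ _; rewrite /elim_entry ltn0 !ltn0 /=; case: q.
have loop p d : p <= m -> exists J,
    run (d + p * n.+2) (start_eliminate yes cond false) (elim_tape J0 M 0 0) =
    run d (start_eliminate yes cond false) (elim_tape J (eliminated M p) p 0).
  elim: p d => [|p IH] d pm; first by exists J0; rewrite addn0.
  have [J e] := IH (d + n.+2) (ltnW pm); have [J' e'] := run_eliminate_row J (eliminated M p) yes cond d pm.
  by exists J'; rewrite mulSn addnA e e'.
have [J e] := loop m (c + n) (leqnn m); rewrite addnA e run_eliminate_columns //.
have [carry [piv [fl [cd el]]]] := eliminate_pass J (eliminated M m) yes cond (leqnn m) (leqnn n).
rewrite ltnn eqxx in el.
eexists; first exact: run_halt el _.
rewrite /=; congr (_ || _ && _); rewrite -all_predC; apply: eq_in_all => t; rewrite mem_iota /= => tn.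
rewrite /elim_entry ltnNge leqnSn /= gtn_eqF // ltnS ltnW //= /reduce eqxx andbT.
by case: (eliminated _ _ _ _); case: (eliminated _ _ _ _).
Qed.

(** * Elimination and membership in the GF(2)-span *)

Fixpoint in_span (rows : seq (nat -> bool)) (d : nat -> bool) :=
  if rows is r :: rows' then in_span rows' d || in_span rows' (fun t => d t (+) r t)
  else all (fun t => ~~ d t) (iota 0 n).

Lemma eq_in_span (T : eqType) (F G : T -> nat -> bool) s (d e : nat -> bool) :
  (forall q t, q \in s -> t < n -> F q t = G q t) -> (forall t, t < n -> d t = e t) ->
  in_span (map F s) d = in_span (map G s) e.
Proof.
elim: s d e => [|q s IH] d e FG de /=.
  by apply: eq_in_all => t; rewrite mem_iota /= => /de ->.
have sub q' t : q' \in s -> t < n -> F q' t = G q' t by move=> qs; apply: FG; rewrite inE qs orbT.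
by congr (_ || _); apply: IH => // t tn; rewrite ?de // FG // inE eqxx.
Qed.

Definition reduce_by (r x : nat -> bool) t :=
  x t (+) (r t && has (fun s => (r s && ~~ has r (iota 0 s)) && x s) (iota 0 t.+1)).

(** Left of its first one [j] the row [r] vanishes, so wherever [r t] holds the scan has already met
    [j]. *)
Lemma reduce_byE (r : nat -> bool) : has r (iota 0 n) -> exists j, [/\ j < n, r j &
  forall x t, reduce_by r x t = x t (+) (r t && x j)].
Proof.
move=> hr; have ex : exists s, r s by case/hasP: hr => s _ rs; exists s.
pose j := ex_minn ex; have [rj minj] : r j /\ forall s, r s -> j <= s.
  by rewrite /j; case: ex_minnP.
exists j; split=> //.
  by case/hasP: hr => s; rewrite mem_iota => /= sn /minj js; apply: leq_ltn_trans sn.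
have first s : (r s && ~~ has r (iota 0 s)) = (s == j).
  apply/andP/eqP => [[rs /hasPn no]|->].
    apply/eqP; rewrite eqn_leq minj // andbT leqNgt; apply/negP => js.
    by have := no j; rewrite mem_iota /= js rj => /(_ isT).
  by split=> //; apply/hasPn => t; rewrite mem_iota /= => tj; apply/negP => /minj; rewrite leqNgt tj.
move=> x t; rewrite /reduce_by; case rt: (r t) => //; congr (_ (+) _); rewrite andTb.
rewrite (@eq_has _ _ (fun s => (s == j) && x s)) => [|s]; last by rewrite first.
apply/hasP/idP => [[s _ /andP[/eqP -> //]]|xj].
by exists j; rewrite ?mem_iota ?eqxx //= ltnS minj.
Qed.

(** Adding [x j] times [r] to [x] is a linear projection with kernel spanned by [r]; if [r] is zero
    it is the identity. *)
Lemma in_span_reduce (r : nat -> bool) (F : nat -> nat -> bool) s d :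
  in_span [seq reduce_by r (F q) | q <- s] (reduce_by r d) = in_span (r :: map F s) d.
Proof.
have [hr|nr] := boolP (has r (iota 0 n)); last first.
  have r0 t : t < n -> r t = false.
    by move=> tn; apply/negbTE; move/hasPn: nr; apply; rewrite mem_iota.
  rewrite /= (@eq_in_span _ F F s (fun t => d t (+) r t) d) // ?orbb.
    by apply: eq_in_span => [q t _|t] tn; rewrite /reduce_by r0 // addbF.
  by move=> t /r0 ->; rewrite addbF.
have [j [jn rj redE]] := reduce_byE hr; rewrite /=.
elim: s d => [|q s IH] d /=.
  apply/allP/orP => [dz|[]/allP dz t tn]; last 2 first.
  - by rewrite redE (negbTE (dz t tn)) (negbTE (dz j _)) ?mem_iota // andbF.
  - have := dz t tn; have := dz j; rewrite mem_iota rj addbT negbK redE => /(_ jn) ->.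
    by rewrite andbT.
  case dj: (d j); [right|left]; apply/allP => t tn; have := dz t tn; rewrite redE dj.
    by rewrite andbT.
  by rewrite andbF addbF.
have -> : in_span [seq reduce_by r (F q) | q <- s] (fun t => reduce_by r d t (+) reduce_by r (F q) t) =
    in_span [seq reduce_by r (F q) | q <- s] (reduce_by r (fun t => d t (+) F q t)).
  apply: eq_in_span => // t _; rewrite !redE.
  by case: (d t) (d j) (F q t) (F q j) (r t) => [] [] [] [] [].
rewrite !IH orbACA; congr ((_ || _) || (_ || _)).
by apply: eq_in_span => // t _; rewrite addbAC.
Qed.

Lemma eliminatedP M :
  all (fun t => eliminated M m m.+1 t == eliminated M m m t) (iota 0 n) =
  in_span (map M (iota 0 m)) (fun t => M m.+1 t (+) M m t).
Proof.
have step p : p <= m ->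
    in_span (map M (iota 0 m)) (fun t => M m.+1 t (+) M m t) =
    in_span (map (eliminated M p) (iota p (m - p)))
      (fun t => eliminated M p m.+1 t (+) eliminated M p m t).
  elim: p => [|p IH] pm; first by rewrite subn0.
  rewrite IH ?(ltnW pm) // -(subnSK pm) /= -[LHS]/(in_span (eliminated M p p :: _) _) -in_span_reduce.
  set M' := eliminated M p.
  have redE q t : reduce M' p q t = reduce_by (M' p) (M' q) t.
    by rewrite /reduce /reduce_by (ltn_eqF pm).
  apply: eq_in_span => [q t _ _|t tn]; first by rewrite redE.
  rewrite !redE.
  have [hr|nr] := boolP (has (M' p) (iota 0 n)).
    have [j [_ _ e]] := reduce_byE hr; rewrite !e.
    by case: (M' p t) (M' m t) (M' m.+1 t) (M' m j) (M' m.+1 j) => [] [] [] [] [].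
  have red0 x : reduce_by (M' p) x t = x t.
    rewrite /reduce_by; have /negbTE -> : ~~ M' p t by move/hasPn: nr; apply; rewrite mem_iota.
    by rewrite addbF.
  by rewrite !red0.
rewrite (step m) // subnn /=; apply: eq_all => t.
by case: (eliminated _ _ _ _); case: (eliminated _ _ _ _).
Qed.

Lemma run_algorithm M c : exists2 s,
  run (c + (n + m * n.+2).+1 + (n * n.*2.+2).+1) (start_compare true false) (bit_tape M 0) = Some s &
  accept s = all_col_twins M && ~~ some_mixed_pair M ||
     extra_condition M && in_span (map M (iota 0 m)) (fun t => M m.+1 t (+) M m t).
Proof.
have -> : bit_tape M 0 = pair_tape M 0 0 xpred0 by [].
rewrite run_pairs addnS run_count.
have [s e a] := run_eliminate M (all_col_twins M && ~~ some_mixed_pair M) (extra_condition M) c.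
by exists s; rewrite ?e // a eliminatedP.
Qed.

End Algorithm.

(** * Correctness *)

Section Correctness.
Variables (n : nat) (E : {set {set 'I_n}}) (w1 w2 : config n) (v0 : 'I_n).

Definition rows := rev (enum E).
Definition num_edges := size rows.

Local Notation m := num_edges.

(* The sweeps read the tape from right to left, so columns and hyperedges come in reverse order. *)
Definition columns := rev (enum 'I_n).
Definition vertex t := nth v0 columns t.
Definition rank v := index v columns.

Definition input_matrix q t :=
  if q < m then vertex t \in nth set0 rows q else if q == m then w2 (vertex t) else w1 (vertex t).

Local Notation M := input_matrix.

Lemma size_columns : size columns = n.
Proof. by rewrite size_rev size_enum_ord. Qed.

Lemma columns_uniq : uniq columns.
Proof. by rewrite rev_uniq enum_uniq. Qed.

Lemma mem_columns v : v \in columns.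
Proof. by rewrite mem_rev mem_enum. Qed.

Lemma rankK v : vertex (rank v) = v.
Proof. by rewrite /vertex nth_index ?mem_columns. Qed.

Lemma vertexK t : t < n -> rank (vertex t) = t.
Proof. by move=> tn; rewrite /rank index_uniq ?size_columns ?columns_uniq. Qed.

Lemma map_vertex T (f : 'I_n -> T) : [seq f (vertex t) | t <- iota 0 n] = [seq f v | v <- columns].
Proof. by rewrite -[X in iota 0 X]size_columns -{2}(mkseq_nth v0 columns) -map_comp. Qed.

Lemma map_rows T (f : {set 'I_n} -> T) :
  [seq f (nth set0 rows q) | q <- iota 0 m] = [seq f e | e <- rows].
Proof. by rewrite -{2}(mkseq_nth set0 rows) -map_comp. Qed.

Lemma row_edge q t : q < m -> M q t = (vertex t \in nth set0 rows q).
Proof. by rewrite /input_matrix => ->. Qed.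

Lemma row_w2 t : M m t = w2 (vertex t).
Proof. by rewrite /input_matrix ltnn eqxx. Qed.

Lemma row_w1 t : M m.+1 t = w1 (vertex t).
Proof. by rewrite /input_matrix ltnNge leqnSn gtn_eqF. Qed.

Lemma mealy_convert_row i (f : 'I_n -> bool) s :
  mealy convert i [seq Some (f v) | v <- s] = (i, [seq inr (f v, false, false, false) | v <- s]).
Proof. by elim: s => [|v s IH] //=; rewrite IH. Qed.

Lemma mealy_encode : rev (mealy convert (Some true) (encode E w1 w2)).2 = bit_tape m n M 0.
Proof.
pose row (h : header) (f : 'I_n -> bool) : seq letter :=
  inl h :: [seq inr (f v, false, false, false) | v <- columns].
pose cells (f : 'I_n -> bool) : seq letter := [seq inr (f v, false, false, false) | v <- enum 'I_n].
pose ecells (e : {set 'I_n}) := cells (fun v => v \in e) ++ [:: inl (None, false)].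
have edges s : mealy convert None (flatten [seq enc_edge e ++ [:: None] | e : {set 'I_n} <- s]) =
    (None, flatten [seq ecells e | e <- s]).
  elim: s => [|e s IH] //=; apply: mealy_cat IH.
  by apply: mealy_cat; first exact: mealy_convert_row.
have -> : mealy convert (Some true) (encode E w1 w2) = (None, cells w1 ++ inl (Some true, false) ::
    cells w2 ++ inl (Some false, false) :: flatten [seq ecells e | e <- enum E]).
  apply: mealy_cat; first exact: mealy_convert_row.
  rewrite /= (mealy_cat (mealy_convert_row (Some false) w2 _) (_ : _ = (None, inl (Some false, false) ::
    flatten [seq ecells e | e <- enum E]))) //=.
  by rewrite edges.
rewrite /= !(rev_cat, rev_cons) rev_flatten -map_comp -map_rev !cat_rcons -!catA.
have revcells f : rev (cells f) = [seq inr (f v, false, false, false) | v <- columns].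
  by rewrite /cells -map_rev.
rewrite /bit_tape /tape -addn2 iotaD map_cat flatten_cat /= cats0.
congr (_ ++ _).
  congr flatten; rewrite -/rows -map_rows; apply/eq_in_map => q; rewrite mem_iota /= => qm.
  rewrite rev_cat revcells kind_edge //=; congr cons; rewrite -map_vertex.
  by apply: eq_map => t; rewrite row_edge.
rewrite !revcells add0n kind_w2 kind_w1 -!map_vertex ltn0 /= -cat_cons; congr (_ :: _ ++ _ :: _).
  by apply: eq_map => t; rewrite row_w2.
by apply: eq_map => t; rewrite row_w1.
Qed.

Lemma size_encode : size (encode E w1 w2) = m.+2 * n.+1.
Proof.
by rewrite -(size_mealy convert (Some true)) -size_rev mealy_encode size_tape.
Qed.

Lemma has_vertex (P : pred 'I_n) : has (fun t => P (vertex t)) (iota 0 n) = [exists v, P v].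
Proof.
have := has_map vertex P (iota 0 n); rewrite (map_vertex id) map_id => <-.
by apply/hasP/existsP => [[v _ Pv]|[v Pv]]; exists v; rewrite ?mem_columns.
Qed.

Lemma all_vertex (P : pred 'I_n) : all (fun t => P (vertex t)) (iota 0 n) = [forall v, P v].
Proof.
rewrite -[LHS]negbK -has_predC (has_vertex (predC P)) negb_exists.
by apply: eq_forallb => v; rewrite /= negbK.
Qed.

Lemma count_vertex (P : pred 'I_n) : count (fun t => P (vertex t)) (iota 0 n) = #|P|.
Proof.
have := count_map vertex P (iota 0 n); rewrite (map_vertex id) map_id => <-.
by rewrite count_rev cardE size_filter enumT.
Qed.

Lemma has_rows (P : pred {set 'I_n}) :
  has (fun q => P (nth set0 rows q)) (iota 0 m) = [exists e in E, P e].
Proof.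
have := has_map (nth set0 rows) P (iota 0 m); rewrite (map_rows id) map_id => <-.
by rewrite has_rev; apply/hasP/exists_inP => -[e]; rewrite ?mem_enum => eE Pe; exists e; rewrite ?mem_enum.
Qed.

Lemma col_twinE u t : col_twin m M u t = twin E (vertex u) (vertex t).
Proof.
rewrite -[LHS]negbK -has_predC.
rewrite (_ : has _ _ = [exists e in E, (vertex u \in e) != (vertex t \in e)]).
  by rewrite negb_exists_in; apply: eq_forallb => e; rewrite negbK.
rewrite -(has_rows (fun e => (vertex u \in e) != (vertex t \in e))).
by apply: eq_in_has => q; rewrite mem_iota /= => qm; rewrite !row_edge.
Qed.

(** In each twin class, the vertex of least [rank]. *)
Definition representatives := [set v | ~~ nonrep m n M (rank v)].
Local Notation R := representatives.

Lemma nonrepE v : nonrep m n M (rank v) = [exists u, twin E u v && (rank u < rank v)].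
Proof.
rewrite -has_vertex; apply: eq_in_has => u; rewrite mem_iota /= => un.
by rewrite col_twinE rankK vertexK.
Qed.

Lemma rep_ex u : exists2 r, r \in R & twin E u r.
Proof.
case: (@arg_minnP _ u (twin E u) rank (twin_refl E u)) => r ur rmin; exists r => //.
rewrite inE nonrepE; apply/existsPn => u'; apply/negP => /andP[u'r].
by rewrite ltnNge rmin // (twin_trans ur) // twin_sym.
Qed.

Lemma rep_uniq : {in R &, forall r r', twin E r r' -> r = r'}.
Proof.
move=> r r'; rewrite !inE !nonrepE => /existsPn/(_ r') + /existsPn/(_ r) + rr'.
rewrite twin_sym rr' /= -!leqNgt => le ge.
by rewrite -(rankK r) -(rankK r'); congr vertex; apply/eqP; rewrite eqn_leq le ge.
Qed.

Lemma rep_countE q (P : pred 'I_n) : (forall t, M q t = P (vertex t)) ->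
  rep_count m n M q = #|[set r in R | P r]|.
Proof.
move=> MP; rewrite -(@eq_card _ (fun r => P r && ~~ nonrep m n M (rank r))) => [|r]; last first.
  by rewrite !inE andbC.
rewrite -count_vertex; apply: eq_in_count => t; rewrite mem_iota /= => tn.
by rewrite MP vertexK.
Qed.

Lemma rep_count_edge q : q < m -> rep_count m n M q = #|nth set0 rows q :&: R|.
Proof.
move=> qm; rewrite (rep_countE (P := fun v => v \in nth set0 rows q)) => [|t]; last exact: row_edge.
by apply: eq_card => r; rewrite !inE andbC.
Qed.

Lemma some_bigE : some_big m n M = big E R.
Proof.
rewrite /big -(has_rows (fun e => 2 < #|e :&: R|)); apply: eq_in_has => q.
by rewrite mem_iota /= => qm; rewrite rep_count_edge.
Qed.

Lemma some_holeE : some_hole m n M = hole E R.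
Proof.
rewrite /hole -(has_rows (fun e => #|e :&: R| == 1)); apply: eq_in_has => q.
by rewrite mem_iota /= => qm; rewrite rep_count_edge.
Qed.

Lemma all_col_twinsE : all_col_twins m n M = all_twins E.
Proof.
rewrite /all_twins -all_vertex; apply: eq_all => u; rewrite -all_vertex; apply: eq_all => t.
exact: col_twinE.
Qed.

Lemma some_mixed_pairE : some_mixed_pair m n M = mixed E w1.
Proof.
rewrite /mixed -has_vertex; apply: eq_has => u; rewrite -has_vertex; apply: eq_has => t.
by rewrite /mixed_pair col_twinE !row_w1; case: (w1 _); case: (w1 _).
Qed.

Lemma in_span_flips (l : seq {set 'I_n}) (x s : config n) :
  in_span n [seq (fun t => vertex t \in (e : {set 'I_n})) | e <- l]
    (fun t => x (vertex t) (+) s (vertex t)) = flips l x s.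
Proof.
elim: l x => [|e l IH] x /=.
  rewrite (all_vertex (fun v => ~~ (x v (+) s v))); apply/forallP/eqP => [h|-> v]; last by rewrite addbb.
  by apply/ffunP => v; have := h v; case: (x v); case: (s v).
rewrite -!IH; congr (_ || _); apply: eq_in_span => // t _.
by rewrite switchE addbAC.
Qed.

Lemma algorithmP : hconnected E -> (forall e, e \in E -> e != set0) -> (exists v, w1 v) ->
  reflect (recurrent E w1 w2)
    (all_col_twins m n M && ~~ some_mixed_pair m n M ||
     extra_condition m n M && in_span n (map M (iota 0 m)) (fun t => M m.+1 t (+) M m t)).
Proof.
move=> conn edge0 w0; have := recurrentP conn edge0 rep_ex rep_uniq w2 w0.
congr (reflect _ (_ || _)); first by rewrite all_col_twinsE some_mixed_pairE.
rewrite andbC; congr (_ && _).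
  rewrite /extra_condition some_mixed_pairE some_bigE some_holeE.
  congr (_ || if _ then _ else _ <= _).
    by rewrite (eq_all row_w2) all_vertex negb_forall.
  by rewrite (rep_countE row_w2) /reps.
transitivity (flips rows w1 w2).
  by apply/idP/idP; apply: flips_sub => e; rewrite mem_rev.
rewrite -in_span_flips.
rewrite (@eq_in_span n _ M (fun q t => vertex t \in nth set0 rows q) (iota 0 m) _
  (fun t => w1 (vertex t) (+) w2 (vertex t))) => [|q t|t _].
- by rewrite -map_rows.
- by rewrite mem_iota => /andP[_ qm] _; apply: row_edge.
by rewrite row_w1 row_w2.
Qed.

End Correctness.

(** There are at most quadratically many passes in the input length [L], each of at most [L.*2.+2]
    steps. *)
Lemma pass_count_bound m n L : L = m.+2 * n.+1 ->
  L.+1 + ((n + m * n.+2).+1 + (n * n.*2.+2).+1).+1 * L.*2.+2 <= 3 * L.+1 ^ 3.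
Proof.
move=> eL; have : ((n + m * n.+2).+1 + (n * n.*2.+2).+1).+1 <= L.+1 * L.+1 by rewrite eL; nia.
move: (_.+1) => t; rewrite -muln2 !expnS expn0 muln1; move: L {eL} => L; nia.
Qed.

Theorem theorem2 :
  exists (M : TM) (c k : nat),
    forall (n : nat) (E : {set {set 'I_n}}) (w1 w2 : config n),
      hconnected E ->
      (forall e, e \in E -> 2 < #|e|) ->
      (exists v, w1 v) ->
      exists cf : tconf M,
        tm_run (c * (size (encode E w1 w2)).+1 ^ k) (tm_init M (encode E w1 w2))
          = Some cf
        /\ (@tm_accept M cf.1.1 <-> recurrent E w1 w2).
Proof.
exists (sweep_machine (Some true) convert (start_compare true false) pass turn accept), 3, 3.
move=> n E w1 w2 conn edge2 w0; have [v0 _] := w0.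
have edge0 e : e \in E -> e != set0.
  by move/edge2; rewrite -card_gt0; apply: ltn_trans.
have [s run_s acc_s] := run_algorithm (num_edges E) n (input_matrix E w1 w2 v0) 0.
have [|cf [runs acc]] := @sweep_machine_run _ _ _ (Some true) convert (start_compare true false) pass turn accept
  (encode E w1 w2) _ (3 * (size (encode E w1 w2)).+1 ^ 3) s (etrans (congr1 _ (mealy_encode E w1 w2 v0)) run_s).
  exact/pass_count_bound/size_encode.
exists cf; split=> //; rewrite acc acc_s.
by split=> /(algorithmP w2 v0 conn edge0 w0).
Qed.
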